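(* Let $(G,\mathbf p)$ be a framework (with $\mathbf p$ pinned) with $\dim(K)=1$. Suppose that for some integer $k\ge 2$, $(G,\mathbf p)$ has a $(1,k-1)$-flex but no $(1,k)$-flex. Then $(G,\mathbf p)$ is rigid and its rigidity order is $k$. Moreover, if $(G,\mathbf p)$ has a $(1,k)$-flex, then either it is flexible, or it is rigid with rigidity order at least $k+1$.
   Context: Fix a dimension $d$. A configuration is $\mathbf p=(\mathbf p_1,\dots,\mathbf p_n)$ with $\mathbf p_i\in\mathbb R^d$; a framework $(G,\mathbf p)$ consists of a graph $G$ on $\{1,\dots,n\}$ and a configuration, with $\mathbf p_i\neq \mathbf p_j$ for every edge $ij$. $(G,\mathbf q)$ is equivalent to $(G,\mathbf p)$ if $|\mathbf q_i-\mathbf q_j|=|\mathbf p_i-\mathbf p_j|$ for all edges $ij$. A configuration $\mathbf q$ is in $\ell$-pinned position if $\mathbf q_1=0$ and, for $2\le i\le \ell+1$, $\mathbf q_i$ lies in the span of $e_1,\dots,e_{i-1}$; these form a linear space ($\ell$-pinned configuration space). If $\mathbf p$ has $\ell$-dimensional affine span, it is pinned if $\mathbf p_1,\dots,\mathbf p_{\ell+1}$ are affinely independent and $\mathbf p$ is in $\ell$-pinned position. Throughout, $\mathbf p$ is pinned with $\ell$-dimensional affine span and all configurations, trajectories and flexes are $\ell$-pinned. $(G,\mathbf p)$ is rigid if there is a neighborhood $U$ of $\mathbf p$ such that every $\ell$-pinned $\mathbf q\in U$ with $(G,\mathbf q)$ equivalent to $(G,\mathbf p)$ equals $\mathbf p$;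 otherwise flexible. A trajectory at $\mathbf p$ is an analytic non-constant map $t\mapsto \mathbf p(t)$ into $\ell$-pinned configuration space, defined for $t\in[0,\varepsilon]$, $\varepsilon>0$, with $\mathbf p(0)=\mathbf p$. A $C^k$ function $\varphi(t)$ is $k$-vanishing if $\varphi^{(i)}(0)=0$ for $1\le i\le k$, and $k$-active if it is $(k-1)$-vanishing but not $k$-vanishing. Let $\mathbf m(\mathbf q)=(|\mathbf q_i-\mathbf q_j|^2)_{ij\in E(G)}$. For integers $j,k\ge1$, a $(j,k)$-flex of $(G,\mathbf p)$ is a $j$-active trajectory $\mathbf p(t)$ at $\mathbf p$ with $\mathbf m(\mathbf p(t))$ $k$-vanishing. $K$ denotes the linear space of $\ell$-pinned $\mathbf p'$ with $(\mathbf p_v-\mathbf p_w)\cdot(\mathbf p'_v-\mathbf p'_w)=0$ for every edge $vw$ (equivalently, $0$ together with all $\mathbf p'$ such that $\mathbf p+\mathbf p't$ is a $(1,1)$-flex). A stiff-bar energy at $\mathbf p$ is $E(\mathbf q)=\sum_{ij\in E(G)}E_{ij}(|\mathbf q_i-\mathbf q_j|)$ on $\ell$-pinned configurations, where each $E_{ij}$ is analytic at $d_{ij}=|\mathbf p_i-\mathbf p_j|\neq0$, has a strict local minimum at $d_{ij}$, and $E_{ij}''(d_{ij})>0$. For $E$ with a local minimum at $\mathbf p$ and $s>0$: $E$ grows always-$s$-quickly at $\mathbf p$ if there are $c_1>0$ and a neighborhood $U$ of $\mathbf p$ with $E(\mathbf q)-E(\mathbf p)\ge c_1|\mathbf q-\mathbf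 p|^s$ on $U$; sometimes-$s$-slowly if there are a trajectory $\mathbf p(t)$ at $\mathbf p$ and $c_2,\delta>0$ with $E(\mathbf p(t))-E(\mathbf p)\le c_2|\mathbf p(t)-\mathbf p|^s$ for $t\in[0,\delta]$; $s$ is the tight growth order if both hold. For a rigid framework, all stiff-bar energies at $\mathbf p$ have the same rational tight growth order $s$, and the rigidity order of $(G,\mathbf p)$ is $\nu=s/2$. *)

(* Defs.v *)
From HB Require Import structures.
From mathcomp Require Import all_boot all_order all_algebra.
From mathcomp Require Import all_classical all_reals all_analysis.
Set Implicit Arguments.
Unset Strict Implicit.
Unset Printing Implicit Defensive.
Import Order.TTheory GRing.Theory Num.Theory.
Import numFieldNormedType.Exports.
Local Open Scope ring_scope.
Local Open Scope classical_set_scope.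

Section Frameworks.
Variables (R : realType) (n d : nat).

(* A configuration: row i is the point p_i in R^d (vertices are 0-based). *)
Definition config := 'M[R]_(n, d).

Definition simple_graph (G : rel 'I_n) :=
  (forall i j, G i j = G j i) /\ (forall i, ~~ G i i).

Definition dotp (u v : 'rV[R]_d) : R := \sum_(k < d) u ord0 k * v ord0 k.

Definition sqdist (q : config) (i j : 'I_n) : R := dotp (row i q - row j q) (row i q - row j q).
Definition dist (q : config) (i j : 'I_n) : R := Num.sqrt (sqdist q i j).

Definition cnorm (q : config) : R := Num.sqrt (\sum_(i < n) \sum_(k < d) q i k ^+ 2).

Definition framework (G : rel 'I_n) (p : config) :=
  simple_graph G /\ forall i j, G i j -> row i p != row j p.

Definition equivalent (G : rel 'I_n) (p q : config) :=
  forall i j, G i j -> dist q i j = dist p i j.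

(* l-pinned position (0-based): q_0 = 0, and for 1 <= i <= l the point q_i
   lies in span(e_0,...,e_{i-1}), i.e. its coordinates k >= i vanish. *)
Definition pinned_pos (l : nat) (q : config) :=
  forall (i : 'I_n) (k : 'I_d), (i <= l)%N -> (i <= k)%N -> q i k = 0.

Definition affine_dim (p : config) : nat :=
  \dim <<[seq row i p - row j p | i <- enum 'I_n, j <- enum 'I_n]>>%VS.

Definition aff_indep (s : seq 'rV[R]_d) : bool :=
  if s is x :: s' then free [seq y - x | y <- s'] else true.

Definition pinned (l : nat) (p : config) :=
  [/\ affine_dim p = l, (l < n)%N,
      aff_indep [seq row i p | i : 'I_n <- enum 'I_n & (nat_of_ord i <= l)%N] & pinned_pos l p].

Definition analytic_at (f : R -> R) (x0 : R) :=
  exists (a : nat -> R) (r : R), 0 < r /\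
    forall t, `|t - x0| < r ->
      (fun N : nat => \sum_(0 <= m < N) a m * (t - x0) ^+ m) @ \oo --> f t.

(* A trajectory at p, defined on [0,eps]: an analytic (i.e. extending to a
   real-analytic map on a neighbourhood of [0,eps]) non-constant map into
   l-pinned configuration space with pt 0 = p. *)
Definition trajectory (l : nat) (p : config) (pt : R -> config) (eps : R) :=
  [/\ 0 < eps,
      forall t0, 0 <= t0 <= eps -> forall i k, analytic_at (fun t => pt t i k) t0,
      forall t, 0 <= t <= eps -> pinned_pos l (pt t),
      pt 0 = p &
      exists t, 0 <= t <= eps /\ pt t != p].

Definition vanishing (k : nat) (f : R -> R) :=
  forall m, (1 <= m <= k)%N -> derive1n m f 0 = 0.

Definition traj_vanishing (k : nat) (pt : R -> config) :=
  forall i j, vanishing k (fun t => pt t i j).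
Definition traj_active (k : nat) (pt : R -> config) :=
  traj_vanishing k.-1 pt /\ ~ traj_vanishing k pt.

Definition edge_vanishing (G : rel 'I_n) (k : nat) (pt : R -> config) :=
  forall i j, G i j -> vanishing k (fun t => sqdist (pt t) i j).

Definition flex (G : rel 'I_n) (l : nat) (p : config) (j k : nat) (pt : R -> config) :=
  (exists eps, trajectory l p pt eps) /\ traj_active j pt /\ edge_vanishing G k pt.
Definition has_flex (G : rel 'I_n) (l : nat) (p : config) (j k : nat) :=
  exists pt, flex G l p j k pt.

Definition inK (G : rel 'I_n) (l : nat) (p p' : config) :=
  pinned_pos l p' /\
  forall v w, G v w -> dotp (row v p - row w p) (row v p' - row w p') = 0.

Definition dimK1 (G : rel 'I_n) (l : nat) (p : config) :=
  exists v, [/\ inK G l p v, v != 0 &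
    forall w, inK G l p w -> exists c : R, w = c *: v].

Definition rigid (G : rel 'I_n) (l : nat) (p : config) :=
  exists delta : R, 0 < delta /\
    forall q, pinned_pos l q -> cnorm (q - p) < delta -> equivalent G p q -> q = p.

(* stiff-bar energy data: one function Eb i j per edge {i,j} (used for i < j) *)
Definition stiff_bar (G : rel 'I_n) (p : config) (Eb : 'I_n -> 'I_n -> R -> R) :=
  forall i j, G i j -> (i < j)%N ->
    let dij := dist p i j in
    [/\ analytic_at (Eb i j) dij,
        (exists r : R, 0 < r /\ forall x, 0 < `|x - dij| < r -> Eb i j dij < Eb i j x) &
        0 < derive1n 2 (Eb i j) dij].

Definition energy (G : rel 'I_n) (Eb : 'I_n -> 'I_n -> R -> R) (q : config) : R :=
  \sum_(i < n) \sum_(j < n | G i j && (i < j)%N) Eb i j (dist q i j).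

Definition grows_always_quickly (l : nat) (E : config -> R) (p : config) (s : R) :=
  exists c1 delta : R, [/\ 0 < c1, 0 < delta &
    forall q, pinned_pos l q -> cnorm (q - p) < delta ->
      c1 * powR (cnorm (q - p)) s <= E q - E p].

Definition grows_sometimes_slowly (l : nat) (E : config -> R) (p : config) (s : R) :=
  exists (pt : R -> config) (eps c2 delta : R),
    [/\ trajectory l p pt eps, 0 < c2, 0 < delta, delta <= eps &
      forall t, 0 <= t <= delta ->
        E (pt t) - E p <= c2 * powR (cnorm (pt t - p)) s].

Definition tight_growth_order (l : nat) (E : config -> R) (p : config) (s : R) :=
  [/\ 0 < s, grows_always_quickly l E p s & grows_sometimes_slowly l E p s].

Definition rigidity_order (G : rel 'I_n) (l : nat) (p : config) (nu : R) :=
  forall Eb, stiff_bar G p Eb -> tight_growth_order l (energy G Eb) p (2 * nu).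

End Frameworks.

(* Main.v *)
Require Import Defs.
From HB Require Import structures.
From mathcomp Require Import all_boot all_order all_algebra.
From mathcomp Require Import all_classical all_reals all_analysis.
From mathcomp Require Import ring lra.
Set Implicit Arguments.
Unset Strict Implicit.
Unset Printing Implicit Defensive.
Import Order.TTheory GRing.Theory Num.Theory.
Import numFieldNormedType.Exports.
Local Open Scope ring_scope.
Local Open Scope classical_set_scope.

(** Let F(x) collect the differences |p_i + x_i - p_j - x_j|^2 - |p_i - p_j|^2
over the edges, together with the coordinates of x that pinning forces to
vanish.  F = L + Q with L linear and Q quadratic, and dim K = 1 says that
ker L is spanned by one vector v.  With a left inverse S of L modulo v, the
equation S F(x) = 0 has a unique formal solution x(t) = t v + O(t^2); its
coefficients obey a Catalan-type recursion, so it converges.  If the first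
nonzero coefficient of F(x(t)) has degree k, comparing x with the truncated
branch at the same v-coordinate gives |F(x)| >= c |x|^k near 0, so (1,k)-flexes
do not exist, while the branch truncated below degree k is a (1,k-1)-flex along
which |F| = O(|x|^k).  If F(x(t)) vanishes identically, the branch is an actual
motion.  Any stiff-bar energy is comparable to |F|^2 near p, whence the order
2k of its growth. *)

(** * Lyapunov-Schmidt reduction at a one-dimensional kernel *)

(** The lower bound on |F| has to hold at every point near 0, not only along analytic curves. For
    each x the branch supplies a reference point X with the same v-coordinate. The difference w = x
    - X then lies in ker phi, where S L is the identity, so applying S to F(x) - F(X) controls w by
    F(x) and by the error of the branch alone. S annihilates the coefficients of F(x(t)), so the
    first nonzero one does not enter the bound on w. It then has to show up in F(x), since all other
    terms on the branch have higher degree in t. Truncated branches are polynomials, so they serve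
    directly as trajectories. Convergence enters when F(x(t)) vanishes identically and genuine zeros
    of F arbitrarily close to 0 have to be produced. The passage from energy to |F|^2 rests on
    E_ij'(d_ij) = 0 and E_ij''(d_ij) > 0. Since d_ij > 0, changes of length and of squared length
    are comparable. *)

Lemma triangular_sum (V : nmodType) (f : nat -> nat -> V) (N : nat) :
  \sum_(m < N) \sum_(i < m.+1) f i (m - i)%N =
  \sum_(0 <= i < N.+1) \sum_(0 <= j < N - i) f i j.
Proof.
elim: N => [|N IH]; first by rewrite big_ord0 big_nat1 subn0 big_geq.
rewrite big_ord_recr /= IH [RHS]big_nat_recr //= subnn.
rewrite [X in _ = _ + X]big_geq // addr0.
rewrite -(big_mkord xpredT (fun i => f i (N - i)%N)) -big_split /=.
apply: eq_big_nat => i /andP[_ iN].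
by rewrite subSn // big_nat_recr.
Qed.

(** The square is cut along the antidiagonal i + j = N. Below it lie complete coefficients of a
    Cauchy product, above it the tail caused by truncation. The triangle carries an empty row i = N
    so that both pieces share one index range. *)
Lemma square_sum_split (V : nmodType) (f : nat -> nat -> V) (N : nat) :
  \sum_(0 <= i < N.+1) \sum_(0 <= j < N.+1) f i j =
  \sum_(m < N) \sum_(i < m.+1) f i (m - i)%N +
  \sum_(0 <= i < N.+1) \sum_(N - i <= j < N.+1) f i j.
Proof.
rewrite triangular_sum -big_split /=; apply: eq_big_nat => i _.
by rewrite -big_cat_nat //= (leq_trans (leq_subr _ _)).
Qed.

Section LyapunovSchmidt.
Context {R : realType} {U : completeNormedModType R} {Y : normedModType R}.
Variables (L : {linear U -> Y}) (B : {bilinear U -> U -> Y}).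
Variables (S : {linear Y -> U}) (phi : {scalar U}) (v : U) (C : R).
Hypothesis Lv : L v = 0.
Hypothesis phiv : phi v = 1.
Hypothesis phiS : forall y, phi (S y) = 0.
Hypothesis SL : forall x, S (L x) = x - phi x *: v.
Hypothesis C1 : 1 <= C.
Hypothesis Lbound : forall x, `|L x| <= C * `|x|.
Hypothesis Sbound : forall y, `|S y| <= C * `|y|.
Hypothesis phibound : forall x, `|phi x| <= C * `|x|.
Hypothesis Bbound : forall x y, `|B x y| <= C * `|x| * `|y|.

Definition quad (x : U) : Y := L x + B x x.

(** Coefficient m + 1 depends on all earlier ones, beyond the reach of structural recursion on m;
    [n] is fuel. For m <= n the fuel runs out only at m = 0, where [v] is the correct value. *)
Fixpoint ls_iter (n m : nat) : U :=
  if n is n'.+1 then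
    if m is m'.+1 then
      - S (\sum_(i < m'.+1) B (ls_iter n' i) (ls_iter n' (m' - i)))
    else v
  else v.

(* The formal series [sum_i t^(i+1) ls_coef i] solves [S (quad x) = 0], [phi x = t]. *)
Definition ls_coef (m : nat) : U := ls_iter m m.

Definition ls_conv (m : nat) : Y :=
  \sum_(i < m.+1) B (ls_coef i) (ls_coef (m - i)).

Definition obstruction (m : nat) : Y := ls_conv m - L (S (ls_conv m)).

(** Coefficient [i] carries the power i + 1, so the polynomial has degree N + 1. *)
Definition ls_branch (N : nat) (t : R) : U :=
  \sum_(0 <= i < N.+1) t ^+ i.+1 *: ls_coef i.

Definition ls_rest (N : nat) (t : R) : Y :=
  \sum_(0 <= i < N.+1) \sum_(N - i <= j < N.+1)
    t ^+ (i + j).+2 *: B (ls_coef i) (ls_coef j).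

Lemma ls_iter_stable n k m : (m <= n)%N -> (m <= k)%N ->
  ls_iter n m = ls_iter k m.
Proof.
elim: n k m => [|n IH] [|k] [|m] //= mn mk.
congr (- S _); apply: eq_bigr => i _.
have im : (i <= m)%N by rewrite -ltnS.
by congr (B _ _); apply: IH; rewrite ?(leq_trans im) ?(leq_trans (leq_subr _ _)).
Qed.

Lemma ls_coef0 : ls_coef 0 = v.
Proof. by []. Qed.

Lemma ls_coefS m : ls_coef m.+1 = - S (ls_conv m).
Proof.
rewrite /ls_coef /=; congr (- S _); apply: eq_bigr => i _.
have im : (i <= m)%N by rewrite -ltnS.
by congr (B _ _); apply: ls_iter_stable; rewrite ?leq_subr.
Qed.

Lemma S_obstruction m : S (obstruction m) = 0.
Proof. by rewrite /obstruction linearB /= SL phiS scale0r subr0 subrr. Qed.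

Lemma phi_ls_branch N t : phi (ls_branch N t) = t.
Proof.
rewrite /ls_branch big_nat_recl // linearD linearZ /= ls_coef0 phiv.
rewrite linear_sum big1_seq ?addr0 ?mulr1 // => i _.
by rewrite ls_coefS linearZ linearN /= phiS oppr0 mulr0.
Qed.

(** Degree 1 disappears because [L v = 0]. In degree m + 2 the linear part contributes
    [L (ls_coef m.+1)], which is - L S of [ls_conv m], and turns the convolution into
    [obstruction m]. Truncation at index N completes exactly the degrees up to N + 1. *)
Lemma quad_ls_branch N t :
  quad (ls_branch N t) =
  \sum_(m < N) t ^+ m.+2 *: obstruction m + ls_rest N t.
Proof.
rewrite /quad {1}/ls_branch big_nat_recl // linearD linearZ /= ls_coef0 Lv.
rewrite scaler0 add0r.
have -> : B (ls_branch N t) (ls_branch N t) =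
    \sum_(m < N) \sum_(i < m.+1)
      t ^+ (i + (m - i)).+2 *: B (ls_coef i) (ls_coef (m - i)) + ls_rest N t.
  rewrite -(square_sum_split
    (fun i j => t ^+ (i + j).+2 *: B (ls_coef i) (ls_coef j))).
  rewrite /ls_branch linear_sumlz; apply: eq_bigr => i _.
  rewrite linear_sumr; apply: eq_bigr => j _.
  by rewrite linearZl_LR linearZr_LR scalerA -exprD addSn addnS.
rewrite addrA big_mkord linear_sum -big_split; congr (_ + _).
apply: eq_bigr => m _ /=.
rewrite ls_coefS linearZ linearN /= /obstruction.
rewrite scalerBr addrC scalerN; congr (_ - _).
rewrite scaler_sumr; apply: eq_bigr => i _.
by rewrite subnKC // -ltnS.
Qed.

Lemma ls_rest_bound N : exists2 D : R, 0 < D &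
  forall t, `|t| <= 1 -> `|ls_rest N t| <= D * `|t| ^+ N.+2.
Proof.
exists (1 + \sum_(0 <= i < N.+1) \sum_(N - i <= j < N.+1)
    `|B (ls_coef i) (ls_coef j)|).
  by rewrite ltr_wpDr // sumr_ge0 // => i _; rewrite sumr_ge0.
move=> t t1; rewrite mulrDl mul1r ler_wpDl ?exprn_ge0 // mulr_suml.
apply: le_trans (ler_norm_sum _ _ _) _.
apply: ler_sum => i _; rewrite mulr_suml.
apply: le_trans (ler_norm_sum _ _ _) _.
apply: ler_sum_nat => j /andP[ij _].
rewrite normrZ mulrC ler_wpM2l // normrX.
by apply: ler_wiXn2l => //; rewrite !ltnS -leq_subLR.
Qed.

Lemma ls_branch_bound N : exists2 A : R, 0 < A &
  forall t, `|t| <= 1 -> `|ls_branch N t| <= A * `|t|.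
Proof.
exists (1 + \sum_(0 <= i < N.+1) `|ls_coef i|).
  by rewrite ltr_wpDr // sumr_ge0.
move=> t t1; rewrite mulrDl mul1r ler_wpDl // mulr_suml.
apply: le_trans (ler_norm_sum _ _ _) _.
apply: ler_sum => i _.
rewrite normrZ mulrC ler_wpM2l // normrX exprS.
by rewrite -[leRHS]mulr1 ler_wpM2l // exprn_ile1.
Qed.

Lemma quad_ls_branch_small N : (forall i, (i < N)%N -> obstruction i = 0) ->
  exists2 D : R, 0 < D &
  forall t, `|t| <= 1 -> `|quad (ls_branch N t)| <= D * `|t| ^+ N.+2.
Proof.
move=> g0; have [D D0 HD] := ls_rest_bound N; exists D => // t t1.
rewrite quad_ls_branch big1 ?add0r; first exact: HD.
by move=> i _; rewrite g0 ?scaler0.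
Qed.

(** Each bilinear term keeps a factor [x - y], and the order of arguments is respected since [B] is
    not assumed symmetric. *)
Lemma quadB x y : quad x - quad y = L (x - y) + (B (x - y) x + B y (x - y)).
Proof.
rewrite /quad linearB linearBl linearBr /= opprD addrACA; congr (_ + _).
by rewrite addrA subrK.
Qed.

Lemma quadB_bound x y :
  `|quad x - quad y| <= C * (1 + `|x| + `|y|) * `|x - y|.
Proof.
rewrite quadB; apply: le_trans (ler_normD _ _) _.
apply: le_trans (lerD (Lbound _) (ler_normD _ _)) _.
apply: le_trans (lerD (lexx _) (lerD (Bbound _ _) (Bbound _ _))) _.
by rewrite le_eqVlt; apply/orP; left; apply/eqP; ring.
Qed.

(** Either the v-coordinate of x is comparable to |x|, and the term t^(m+2) of the obstruction
    dominates; or x is mostly transverse to v, where [quad] is even bounded below linearly. *)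
Lemma quad_lower_bound m :
  (forall i, (i < m)%N -> obstruction i = 0) -> obstruction m <> 0 ->
  exists c delta : R, [/\ 0 < c, 0 < delta &
    forall x, `|x| < delta -> c * `|x| ^+ m.+2 <= `|quad x|].
Proof.
move=> g0 /eqP gm.
(* Truncation at m + 1 rather than m: the obstruction of index m then appears as a full term, and
   the remainder has order m + 3. *)
have [D D0 HD] := ls_rest_bound m.+1.
have [A A0 HA] := ls_branch_bound m.+1.
have C0 : 0 < C by exact: lt_le_trans C1.
have gm0 : 0 < `|obstruction m| by rewrite normr_gt0.
set g := `|obstruction m| in gm0.
pose K := C * (2 + A).
have K0 : 0 < K by rewrite mulr_gt0 // addr_gt0.
pose E := D + K * (2 * C * D).
have E0 : 0 < E by rewrite /E ?(addr_gt0, mulr_gt0).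
pose F := 1 + K * (2 * C).
have F0 : 0 < F by rewrite ?(addr_gt0, mulr_gt0).
pose H := A + 2 * C * D.
have H0 : 0 < H by rewrite ?(addr_gt0, mulr_gt0).
(* [x = ls_branch (phi x) + w]; applying [S] bounds [w] by [quad x]. *)
have key x : `|x| <= 1 -> `|phi x| <= 1 -> C ^+ 2 * (1 + A * C) * `|x| <= 2^-1 ->
    let t := `|phi x| in
    g * t ^+ m.+2 <= F * `|quad x| + E * t ^+ m.+3 /\
    `|x| <= H * t + 2 * C * `|quad x|.
  move=> x1 t1 xs; set t := phi x => /=.
  pose X := ls_branch m.+1 t.
  have HX : `|X| <= A * `|t| := HA _ t1.
  have HX2 : `|X| <= A * C * `|x|.
    by rewrite (le_trans HX) // -mulrA ler_wpM2l ?(ltW A0) ?phibound.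
  have HX3 : `|X| <= A by rewrite (le_trans HX) // ger_pMr.
  have qX : quad X = t ^+ m.+2 *: obstruction m + ls_rest m.+1 t.
    rewrite quad_ls_branch big_ord_recr /= big1 ?add0r // => i _.
    by rewrite g0 ?scaler0.
  have phiw : phi (x - X) = 0 by rewrite linearB /= phi_ls_branch subrr.
  have wE : x - X = S (quad x) - S (ls_rest m.+1 t)
      - S (B (x - X) x + B X (x - X)).
    have : S (quad x - quad X) = S (quad x) - S (ls_rest m.+1 t).
      rewrite linearB /= qX [S (_ *: _ + _)]linearD linearZ /=.
      by rewrite S_obstruction scaler0 add0r.
    by rewrite quadB linearD SL phiw scale0r subr0 => <-; rewrite addrK.
  have HR : `|ls_rest m.+1 t| <= D * `|t| ^+ m.+3 := HD _ t1.
  have Hw : `|x - X| <= 2 * C * `|quad x| + 2 * C * D * `|t| ^+ m.+3.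
    (* By the smallness of x, the nonlinear correction costs at most half of |x - X| and is absorbed
       on the left. *)
    have h1 : `|S (B (x - X) x + B X (x - X))| <= 2^-1 * `|x - X|.
      apply: le_trans (Sbound _) _.
      apply: le_trans (ler_wpM2l (ltW C0) (ler_normD _ _)) _.
      apply: le_trans (ler_wpM2l (ltW C0) (lerD (Bbound _ _) (Bbound _ _))) _.
      apply: le_trans (ler_wpM2r (normr_ge0 _) xs).
      have -> : C * (C * `|x - X| * `|x| + C * `|X| * `|x - X|) =
        C ^+ 2 * (`|x| + `|X|) * `|x - X| by ring.
      rewrite ler_wpM2r // -mulrA ler_wpM2l ?exprn_ge0 ?(ltW C0) //.
      by rewrite mulrDl mul1r lerD2l.
    have h2 : `|x - X| <= C * `|quad x| + C * (D * `|t| ^+ m.+3)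
        + 2^-1 * `|x - X|.
      rewrite {1}wE; apply: le_trans (ler_normB _ _) _; apply: lerD => //.
      apply: le_trans (ler_normB _ _) _; apply: lerD => //.
      by apply: le_trans (Sbound _) _; rewrite ler_wpM2l ?(ltW C0).
    by lra.
  split.
    have h3 : `|quad X - quad x| <= K * `|x - X|.
      apply: le_trans (quadB_bound _ _) _.
      rewrite [`|X - x|]distrC ler_wpM2r // ler_wpM2l ?(ltW C0) //.
      by lra.
    have h4 : g * `|t| ^+ m.+2 <= `|quad X| + `|ls_rest m.+1 t|.
      rewrite mulrC -normrX -normrZ.
      have -> : t ^+ m.+2 *: obstruction m = quad X - ls_rest m.+1 t.
        by rewrite qX addrK.
      exact: ler_normB.
    have h5 : `|quad X| <= `|quad x| + `|quad X - quad x|.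
      by rewrite -{1}[quad X](subrK (quad x)) addrC ler_normD.
    have h6 := ler_wpM2l (ltW K0) Hw.
    rewrite /F /E; lra.
  have h7 : `|x| <= `|X| + `|x - X|.
    by rewrite -{1}[x](subrK X) addrC ler_normD.
  have h8 : `|t| ^+ m.+3 <= `|t|.
    by rewrite exprS -[leRHS]mulr1 ler_wpM2l // exprn_ile1.
  have h9 : 2 * C * D * `|t| ^+ m.+3 <= 2 * C * D * `|t|.
    by rewrite ler_wpM2l // !mulr_ge0 ?ltW.
  rewrite /H; lra.
have CE0 : 0 < 1 + C ^+ 2 * (1 + A * C) + C + 2 * E * C / g.
  by rewrite ?(addr_gt0, mulr_gt0, exprn_gt0, invr_gt0).
(* The sum collects every constant that has to be beaten, so each of them times |x| stays below
   1/2. *)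
pose delta := (2 * (1 + C ^+ 2 * (1 + A * C) + C + 2 * E * C / g))^-1.
have delta0 : 0 < delta by rewrite invr_gt0 mulr_gt0.
have Hdelta x M : `|x| < delta ->
    0 <= M -> M <= 1 + C ^+ 2 * (1 + A * C) + C + 2 * E * C / g ->
    M * `|x| <= 2^-1.
  move=> xd M0 HM; apply: le_trans (ler_pM M0 (normr_ge0 _) HM (ltW xd)) _.
  by rewrite /delta invfM mulrCA divff ?mulr1 // gt_eqF.
pose G := (2 * H) ^+ m.+2 * (2 * F / g) + 4 * C.
have G0 : 0 < G.
  apply: addr_gt0; last exact: mulr_gt0.
  by apply: mulr_gt0; [apply/exprn_gt0/mulr_gt0|apply/divr_gt0/gm0/mulr_gt0].
exists G^-1, delta; split=> [||x xd]; [by rewrite invr_gt0|exact: delta0|].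
have p1 : 0 <= C ^+ 2 * (1 + A * C).
  by rewrite mulr_ge0 ?exprn_ge0 ?addr_ge0 ?mulr_ge0 ?ltW.
have p2 : 0 <= 2 * E * C / g by rewrite !mulr_ge0 ?invr_ge0 ?ltW.
have d1 : 1 * `|x| <= 2^-1 by apply: Hdelta => //; lra.
have d2 : C ^+ 2 * (1 + A * C) * `|x| <= 2^-1 by apply: Hdelta => //; lra.
have d3 : C * `|x| <= 2^-1 by apply: Hdelta => //; lra.
have d4 : 2 * E * C / g * `|x| <= 2^-1 by apply: Hdelta => //; lra.
have x1 : `|x| <= 1 by lra.
have t1 : `|phi x| <= 1 by have := phibound x; lra.
have [k1 k2] := key x x1 t1 d2.
set t := `|phi x| in k1 k2 t1.
have t0 : 0 <= t by exact: normr_ge0.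
have Q0 : 0 <= `|quad x| by [].
have k3 : E * t ^+ m.+3 <= g / 2 * t ^+ m.+2.
  rewrite exprS mulrA ler_wpM2r ?exprn_ge0 //.
  have : 2 * E * C * `|x| <= 2^-1 * g.
    by rewrite -ler_pdivrMr // mulrAC.
  have : E * t <= E * (C * `|x|) by rewrite ler_wpM2l ?(ltW E0) // phibound.
  by lra.
have k4 : t ^+ m.+2 <= 2 * F / g * `|quad x|.
  rewrite mulrAC ler_pdivlMr //; lra.
rewrite mulrC ler_pdivrMr // mulrC.
(* In the second case H t < |x| / 2 is absorbed in [k2], and |x| <= 1 weakens the linear bound to
   the required power. *)
have [xt|xt] := leP `|x| (2 * H * t).
  apply: (@le_trans _ _ ((2 * H) ^+ m.+2 * (2 * F / g) * `|quad x|)).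
    rewrite -mulrA; apply: le_trans (_ : (2 * H) ^+ m.+2 * t ^+ m.+2 <= _).
      rewrite -exprMn; apply: lerXn2r; rewrite ?nnegrE //.
      exact: le_trans xt.
    by rewrite ler_wpM2l // exprn_ge0 // mulr_ge0 // ltW.
  by rewrite ler_wpM2r // /G lerDl mulr_ge0 ?ltW.
apply: (@le_trans _ _ (4 * C * `|quad x|)).
  have : `|x| ^+ m.+2 <= `|x|.
    by rewrite exprS -[leRHS]mulr1 ler_wpM2l // exprn_ile1.
  by lra.
rewrite ler_wpM2r // /G lerDr.
apply: mulr_ge0; first by apply/exprn_ge0/mulr_ge0 => //; exact: ltW.
by apply: divr_ge0; [apply: mulr_ge0|]; rewrite // ltW.
Qed.

(** The partial sums s_N satisfy s_(N+1) <= tau |v| + C^2 s_N^2. The value tau = 1/(4 C^2 A) is the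
    one for which s = A tau + C^2 s^2 has a double root, namely 2 A tau; the bound by this root
    reproduces itself under induction. *)
Lemma ls_majorant : exists tau M : R, [/\ 0 < tau, 0 < M &
  forall N, \sum_(0 <= i < N.+1) tau ^+ i.+1 * `|ls_coef i| <= M].
Proof.
have C0 : 0 < C by exact: lt_le_trans C1.
pose A := `|v| + 1.
have A0 : 0 < A by rewrite ltr_wpDl.
pose tau := (4 * C ^+ 2 * A)^-1.
have tau0 : 0 < tau by rewrite invr_gt0 !mulr_gt0 ?exprn_gt0.
exists tau, (2 * A * tau); split=> //; first by rewrite !mulr_gt0.
have tauE : 4 * C ^+ 2 * A * tau = 1.
  by rewrite divff // gt_eqF // !mulr_gt0 ?exprn_gt0.
elim=> [|N IH].
  rewrite big_nat1 expr1 ls_coef0 mulrC ler_wpM2r ?(ltW tau0) // /A.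
  by have := normr_ge0 v; lra.
set s := \sum_(_ <= _ < _) _ in IH.
have s0 : 0 <= s.
  by apply: sumr_ge0 => i _; rewrite mulr_ge0 ?exprn_ge0 ?(ltW tau0).
have : \sum_(0 <= i < N.+1) tau ^+ i.+2 * `|ls_coef i.+1| <= C ^+ 2 * s ^+ 2.
  apply: (@le_trans _ _ (\sum_(m < N.+1) \sum_(i < m.+1)
    C ^+ 2 * (tau ^+ (i + (m - i)).+2 * (`|ls_coef i| * `|ls_coef (m - i)|)))).
    rewrite big_mkord; apply: ler_sum => m _.
    rewrite ls_coefS normrN.
    apply: le_trans (ler_wpM2l _ (Sbound _)) _; first exact/exprn_ge0/ltW.
    rewrite mulrA.
    apply: le_trans (ler_wpM2l _ (ler_norm_sum _ _ _)) _.
      by rewrite mulr_ge0 ?exprn_ge0 ?ltW.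
    rewrite mulr_sumr; apply: ler_sum => i _.
    rewrite subnKC; last by rewrite -ltnS.
    apply: le_trans (ler_wpM2l _ (Bbound _ _)) _.
      by rewrite mulr_ge0 ?exprn_ge0 ?ltW.
    by rewrite le_eqVlt; apply/orP; left; apply/eqP; ring.
  pose f i j :=
    C ^+ 2 * (tau ^+ (i + j).+2 * (`|ls_coef i| * `|ls_coef j|)).
  have f0 i j : 0 <= f i j.
    apply: mulr_ge0; [exact/exprn_ge0/ltW|apply: mulr_ge0 => //].
    exact/exprn_ge0/ltW.
  have -> : C ^+ 2 * s ^+ 2 =
      \sum_(0 <= i < N.+1) \sum_(0 <= j < N.+1) f i j.
    rewrite [s ^+ 2]expr2 {1}/s mulr_suml mulr_sumr; apply: eq_bigr => i _.
    rewrite !mulr_sumr; apply: eq_bigr => j _.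
    by rewrite /f -addnS -addSn exprD; ring.
  rewrite (triangular_sum f) big_nat_recr //= subnn [X in _ + X <= _]big_geq // addr0.
  rewrite big_nat [leRHS]big_nat; apply: ler_sum => i /andP[_ iN].
  rewrite [leRHS](@big_cat_nat _ _ _ (N.+1 - i)%N) ?leq_subr //=.
  by rewrite lerDl sumr_ge0.
move=> step; rewrite big_nat_recl // expr1 ls_coef0.
have : s ^+ 2 <= (2 * A * tau) ^+ 2 by rewrite lerXn2r ?nnegrE // (le_trans s0).
move=> /(ler_wpM2l (ltW (exprn_gt0 2 C0))).
have -> : C ^+ 2 * (2 * A * tau) ^+ 2 = (4 * C ^+ 2 * A * tau) * (A * tau) by ring.
rewrite tauE mul1r => /(le_trans step) {}step.
rewrite -mulrA mulr_natl mulr2n; apply: lerD step.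
by rewrite mulrC ler_wpM2r ?(ltW tau0) // lerDl.
Qed.

(** Halving the radius of the majorant gives each term of [ls_rest], of degree at least N + 2, a
    gain of 2^-N. The bounds linear in t come from the factor t common to all terms; they let the
    limit be taken as small as desired. *)
Lemma ls_branch_cvg : exists tau M : R, [/\ 0 < tau, 0 < M &
  forall t : R, 0 < t <= tau -> exists x,
    [/\ ls_branch^~ t @ \oo --> x, `|x| <= M * t,
       forall N, `|ls_branch N t| <= M * t &
       forall N, `|ls_rest N t| <= M * 2^-1 ^+ N]].
Proof.
have [tau [M [tau0 M0 HM]]] := ls_majorant.
have C0 : 0 < C by exact: lt_le_trans C1.
have bt (t : R) N : 0 < t <= tau ->
    \sum_(0 <= i < N) `|t ^+ i.+1 *: ls_coef i| <= M / tau * t.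
  move=> /andP[t0 tt].
  apply: (@le_trans _ _ ((\sum_(0 <= i < N.+1) tau ^+ i.+1 * `|ls_coef i|) * (t / tau))).
    rewrite mulr_suml big_nat_recr //=; apply: ler_wpDr.
      rewrite mulr_ge0 ?divr_ge0 ?(ltW t0) ?(ltW tau0) //.
      by rewrite mulr_ge0 // exprn_ge0 // ltW.
    apply: ler_sum => i _; rewrite normrZ normrX (gtr0_norm t0).
    rewrite mulrAC ler_wpM2r // !exprS.
    have -> : tau * tau ^+ i * (t / tau) = t * tau ^+ i.
      by field; rewrite gt_eqF.
    rewrite ler_wpM2l ?(ltW t0) //.
    by rewrite lerXn2r ?nnegrE ?(ltW t0) ?(ltW tau0).
  by rewrite mulrAC -mulrA ler_wpM2r // divr_ge0 // ltW.
pose M' := M / tau + C * M ^+ 2.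
have Mtau : 0 < M / tau by rewrite divr_gt0.
have CM : 0 < C * M ^+ 2 by rewrite mulr_gt0 ?exprn_gt0.
exists (tau / 2), M'; split; [by rewrite divr_gt0|exact: addr_gt0|].
move=> t /andP[t0 tt].
have t0' : 0 < t <= tau by rewrite t0; lra.
have HB N : `|ls_branch N t| <= M / tau * t.
  exact: le_trans (ler_norm_sum _ _ _) (bt _ _ t0').
have HM' : M / tau * t <= M' * t by rewrite ler_wpM2r ?(ltW t0) // lerDl ltW.
have cx : cvgn (series (fun i => t ^+ i.+1 *: ls_coef i)).
  apply: normed_cvg; apply: nondecreasing_is_cvgn.
    by apply: nondecreasing_series => i _ _; exact: normr_ge0.
  by exists (M / tau * t) => _ [N _ <-]; exact: bt.
have cX : ls_branch^~ t @ \oo --> limn (series (fun i => t ^+ i.+1 *: ls_coef i)).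
  by rewrite -cvg_shiftS in cx.
exists (limn (series (fun i => t ^+ i.+1 *: ls_coef i))).
set x := limn _ in cX *.
split=> //.
- apply/ler_addgt0Pr => e e0.
  have [N _ /(_ N (leqnn N)) /= xN] := (cvgrPdist_lt _ _).1 cX _ e0.
  rewrite -(subrK (ls_branch N t) x) addrC (le_trans (ler_normD _ _)) //.
  by rewrite lerD ?(ltW xN) // (le_trans (HB _)).
- by move=> N; apply: le_trans (HB _) _.
move=> N; apply: (@le_trans _ _ (C * M ^+ 2 * 2^-1 ^+ N)); last first.
  by rewrite ler_wpM2r ?exprn_ge0 // lerDr ltW.
apply: (@le_trans _ _ (C * 2^-1 ^+ N *
    (\sum_(0 <= i < N.+1) tau ^+ i.+1 * `|ls_coef i|) ^+ 2)); last first.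
  rewrite mulrAC ler_wpM2r ?exprn_ge0 // ler_wpM2l ?(ltW C0) //.
  apply: lerXn2r; rewrite ?nnegrE ?(ltW M0) //.
  by apply: sumr_ge0 => i _; rewrite mulr_ge0 ?exprn_ge0 // ltW.
rewrite [X in _ <= _ * X]expr2 mulr_suml mulr_sumr.
apply: le_trans (ler_norm_sum _ _ _) _; apply: ler_sum => i _.
rewrite !mulr_sumr.
have pos j : 0 <= C * 2^-1 ^+ N *
    (tau ^+ i.+1 * `|ls_coef i| * (tau ^+ j.+1 * `|ls_coef j|)).
  apply: mulr_ge0; first by rewrite mulr_ge0 ?exprn_ge0 ?(ltW C0).
  by apply: mulr_ge0; apply: mulr_ge0 => //; exact/exprn_ge0/ltW.
rewrite [leRHS](@big_cat_nat _ _ _ (N - i)%N) //=; last first.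
  by rewrite (leq_trans (leq_subr _ _)).
rewrite ler_wpDl ?sumr_ge0 //.
apply: le_trans (ler_norm_sum _ _ _) _.
apply: ler_sum_nat => j /andP[ij _].
rewrite normrZ normrX (gtr0_norm t0).
apply: le_trans (ler_wpM2l _ (Bbound _ _)) _; first exact/exprn_ge0/ltW.
have -> : C * 2^-1 ^+ N *
    (tau ^+ i.+1 * `|ls_coef i| * (tau ^+ j.+1 * `|ls_coef j|)) =
    2^-1 ^+ N * tau ^+ (i + j).+2 * (C * `|ls_coef i| * `|ls_coef j|).
  by rewrite -addnS -addSn exprD; ring.
rewrite ler_wpM2r ?mulr_ge0 ?(ltW C0) //.
apply: (@le_trans _ _ ((tau / 2) ^+ (i + j).+2)).
  by rewrite lerXn2r ?nnegrE ?divr_ge0 ?(ltW t0) ?(ltW tau0).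
rewrite exprMn mulrC ler_wpM2r ?exprn_ge0 ?(ltW tau0) //.
rewrite ler_wiXn2l ?invr_ge0 ?invf_le1 ?ler1n //.
by rewrite leq_subLR in ij; rewrite (leq_trans ij) // -addn2 leq_addr.
Qed.

(** On truncations [quad] equals [ls_rest], which tends to 0, and the local Lipschitz bound carries
    this to the limit. The limit is nonzero because [phi] equals t > 0 on every truncation and is
    bounded. *)
Lemma quad_zeros : (forall m, obstruction m = 0) ->
  forall e : R, 0 < e -> exists x, [/\ x <> 0, `|x| < e & quad x = 0].
Proof.
move=> g0 e e0.
have C0 : 0 < C by exact: lt_le_trans C1.
have [tau [M [tau0 M0 H]]] := ls_branch_cvg.
pose t := Num.min tau (e / (2 * M)).
have t0 : 0 < t by rewrite lt_min tau0 divr_gt0 // mulr_gt0.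
have Mt : M * t < e.
  apply: (@le_lt_trans _ _ (M * (e / (2 * M)))).
    by rewrite ler_wpM2l ?(ltW M0) // ge_min lexx orbT.
  by rewrite invfM mulrCA mulrA mulrACA divff ?gt_eqF // mulr1 mulrC; lra.
have [|x [cX xM XM RM]] := H t; first by rewrite t0 ge_min lexx.
exists x; split; last 2 first.
- exact: le_lt_trans xM Mt.
- apply/eqP/negPn/negP; rewrite -normr_gt0 => q0.
  pose K := M + C * (1 + e + e).
  have K0 : 0 < K by rewrite addr_gt0 // mulr_gt0 // !addr_gt0.
  have eps0 : 0 < `|quad x| / (2 * K) by rewrite divr_gt0 // mulr_gt0.
  have h : `|2^-1 : R| < 1 by rewrite gtr0_norm ?invr_gt0 // invf_lt1 // ltr1n.
  have := (cvgr0Pnorm_lt _).1 (cvg_expr h) _ eps0.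
  have := (cvgrPdist_lt _ _).1 cX _ eps0.
  move=> [N1 _ H1] [N2 _ H2].
  have {}H1 := H1 (maxn N1 N2) (leq_maxl _ _).
  have {}H2 := H2 (maxn N1 N2) (leq_maxr _ _).
  move: H1 H2; set N := maxn N1 N2 => /= H1 H2.
  have q1 : `|quad (ls_branch N t)| <= M * (`|quad x| / (2 * K)).
    rewrite quad_ls_branch big1 ?add0r => [|i _]; last by rewrite g0 scaler0.
    apply: le_trans (RM _) _; rewrite ler_wpM2l ?(ltW M0) //.
    by apply: le_trans (ltW H2); exact: ler_norm.
  have q2 : `|quad x - quad (ls_branch N t)| <=
      C * (1 + e + e) * (`|quad x| / (2 * K)).
    apply: le_trans (quadB_bound _ _) _; apply: ler_pM => //.
    + by rewrite mulr_ge0 ?addr_ge0 ?(ltW C0).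
    + rewrite ler_wpM2l ?(ltW C0) // lerD // ?lerD2l.
        exact: le_trans xM (ltW Mt).
      exact: le_trans (XM N) (ltW Mt).
    + exact: ltW.
  have q3 : `|quad x| <= K * (`|quad x| / (2 * K)).
    rewrite -{1}(subrK (quad (ls_branch N t)) (quad x)) addrC.
    by rewrite (le_trans (ler_normD _ _)) // /K mulrDl lerD.
  move: q3; rewrite invfM mulrCA mulrA mulrACA divff ?gt_eqF // mulr1.
  by move: q0; lra.
move=> x0; rewrite x0 in cX.
have eps0 : 0 < t / (2 * C) by rewrite divr_gt0 // mulr_gt0.
have [N _ /(_ N (leqnn N)) /= xN] := (cvgrPdist_lt _ _).1 cX _ eps0.
have := phibound (ls_branch N t); rewrite phi_ls_branch (gtr0_norm t0).
rewrite sub0r normrN ltr_pdivlMr ?mulr_gt0 // in xN.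
by lra.
Qed.

End LyapunovSchmidt.

(** * Taylor estimates for analytic functions *)

Section Calculus.
Context {R : realType}.
Implicit Types (f g : R -> R) (a r : R).

(** The successive derivatives are witness functions on one fixed ball, which makes sums and
    products immediate inductions; [derive1nSr_near] ties them back to [derive1n]. *)
Fixpoint diff_times (a r : R) (n : nat) (f : R -> R) : Prop :=
  if n is n'.+1 then
    exists2 f', forall x, `|x - a| < r -> is_derive x 1 f (f' x) &
      diff_times a r n' f'
  else True.

Lemma diff_timesW a r n f : diff_times a r n.+1 f -> diff_times a r n f.
Proof.
elim: n f => // n IH f [f' Df Hf']; exists f' => //; exact: IH.
Qed.

Lemma diff_times_radius a r r' n f : r' <= r ->
  diff_times a r n f -> diff_times a r' n f.
Proof.
move=> rr'; elim: n f => // n IH f [f' Df Hf']; exists f'; last exact: IH.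
by move=> x xr; apply: Df; exact: lt_le_trans rr'.
Qed.

Lemma diff_times_cst a r n (c : R) : diff_times a r n (fun=> c).
Proof.
elim: n c => // n IH c; exists (fun=> 0); last exact: IH.
by move=> x _; exact: is_derive_cst.
Qed.

Lemma diff_timesD a r n f g : diff_times a r n f -> diff_times a r n g ->
  diff_times a r n (fun x => f x + g x).
Proof.
elim: n f g => // n IH f g [f' Df Hf] [g' Dg Hg].
exists (fun x => f' x + g' x); last exact: IH.
by move=> x xr; apply: is_deriveD; [exact: Df|exact: Dg].
Qed.

Lemma diff_timesM a r n f g : diff_times a r n f -> diff_times a r n g ->
  diff_times a r n (fun x => f x * g x).
Proof.
elim: n f g => // n IH f g Hf Hg.
have [f' Df Hf'] := Hf; have [g' Dg Hg'] := Hg.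
exists (fun x => f x * g' x + g x * f' x).
  by move=> x xr; apply: is_deriveM; [exact: Df|exact: Dg].
by apply: diff_timesD; apply: IH => //; exact: diff_timesW.
Qed.

Lemma diff_times_sum a r n m (f : 'I_m -> R -> R) :
  (forall i, diff_times a r n (f i)) ->
  diff_times a r n (fun x => \sum_(i < m) f i x).
Proof.
elim: m f => [|m IH] f Hf.
  under eq_fun do rewrite big_ord0; exact: diff_times_cst.
under eq_fun do rewrite big_ord_recr /=.
by apply: diff_timesD => //; apply: IH.
Qed.

Lemma nbhs_dist a r : 0 < r -> \forall x \near a, `|x - a| < r.
Proof.
by move=> r0; near=> x; rewrite distrC; near: x; exact: cvgr_dist_lt.
Unshelve. all: by end_near. Qed.

Lemma derive1nSr_near a r f f' :
  (forall x, `|x - a| < r -> is_derive x 1 f (f' x)) ->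
  forall j x, `|x - a| < r -> derive1n j.+1 f x = derive1n j f' x.
Proof.
move=> Df j; elim: j => [|j IH] x xr.
  by rewrite derive1n1 derive1n0 derive1E; have [_ ->] := Df _ xr.
rewrite (derive1nS f j.+1) (derive1nS f' j) !derive1E.
apply: near_eq_derive.
have : \forall y \near x, `|y - a| < r.
  have e0 : 0 < r - `|x - a| by rewrite subr_gt0.
  apply: filterS (nbhs_dist x e0) => y yx.
  rewrite -(subrK x y) -addrA (le_lt_trans (ler_normD _ _)) //.
  by rewrite -ltrBrDr.
by apply: filterS => y yr; exact: IH.
Qed.

Lemma is_derive_bound f f' a r (M : R) : 
  (forall x, `|x - a| < r -> is_derive x 1 f (f' x)) ->
  forall x, `|x - a| < r ->
  (forall y, `|y - a| <= `|x - a| -> `|f' y| <= M) ->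
  `|f x - f a| <= M * `|x - a|.
Proof.
move=> Df x xr HM.
have cf u v : `|u - a| < r -> `|v - a| < r ->
    {within `[u, v], continuous f}%classic.
  move=> ar br; apply: derivable_within_continuous => y.
  rewrite in_itv /= => /andP[ay yb].
  suff /Df[] : `|y - a| < r by [].
  move: ar br; rewrite !ltr_norml; lra.
have r0 : 0 < r by exact: le_lt_trans xr.
have aa : `|a - a| < r by rewrite subrr normr0.
have [xa|xa|->] := ltgtP x a; last by rewrite !subrr normr0 mulr0.
- have [|c cxx E] := @MVT R f f' x a xa _ (cf _ _ xr aa).
    move=> y; rewrite in_itv /= => /andP[ay yb]; apply: Df.
    by move: xr; rewrite !ltr_norml; lra.
  rewrite distrC E normrM [`|a - x|]distrC ler_wpM2r // HM //.
  move: cxx; rewrite in_itv /= => /andP[c1 c2].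
  by rewrite !ltr0_norm ?subr_lt0 //; lra.
- have [|c cxx E] := @MVT R f f' a x xa _ (cf _ _ aa xr).
    move=> y; rewrite in_itv /= => /andP[ay yb]; apply: Df.
    by move: xr; rewrite !ltr_norml; lra.
  rewrite E normrM ler_wpM2r // HM //.
  move: cxx; rewrite in_itv /= => /andP[c1 c2].
  by rewrite !gtr0_norm ?subr_gt0 //; lra.
Qed.

Lemma is_derive_sum_apply n (h : 'I_n -> R -> R) (dh : 'I_n -> R) (x : R) :
  (forall i, is_derive x 1 (h i) (dh i)) ->
  is_derive x 1 (fun y => \sum_(i < n) h i y) (\sum_(i < n) dh i).
Proof.
elim: n h dh => [|n IH] h dh H.
  by under eq_fun do rewrite big_ord0; rewrite big_ord0; exact: is_derive_cst.
under eq_fun do rewrite big_ord_recr /=; rewrite big_ord_recr /=.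
exact: is_deriveD (IH _ _ (fun i => H (widen_ord (leqnSn n) i))) (H ord_max).
Qed.

Lemma is_derive_monomial (c a : R) n (x : R) :
  is_derive x 1 (fun y => c * (y - a) ^+ n.+1) (c * (n.+1%:R * (x - a) ^+ n)).
Proof.
have -> : (fun y => c * (y - a) ^+ n.+1) = horner (c *: ('X - a%:P) ^+ n.+1).
  by apply/funext => y; rewrite hornerZ horner_exp !hornerE.
apply: is_derive_eq.
rewrite derivZ deriv_exp derivXsubC mul1r hornerZ hornerMn horner_exp !hornerE.
by rewrite /= -mulrA mulr_natl.
Qed.

Definition taylor_poly (k : nat) f a (x : R) : R :=
  \sum_(j < k) derive1n j f a / j`!%:R * (x - a) ^+ j.

(** Differentiating the remainder of f gives the remainder of f' of one order less, and the mean
    value inequality raises the exponent by one. At k = 0 the single derivative provides continuity,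
    hence a local bound. *)
Lemma taylor k f a r : 0 < r -> diff_times a r k.+1 f ->
  exists C delta : R, [/\ 0 < C, 0 < delta & forall x, `|x - a| < delta ->
    `|f x - taylor_poly k f a x| <= C * `|x - a| ^+ k].
Proof.
move=> r0; elim: k f => [|k IH] f [f' Df Hf'].
  have cf : f @ a --> f a.
    apply/differentiable_continuous/derivable1_diffP.
    by have [] : is_derive a 1 f (f' a) by apply: Df; rewrite subrr normr0.
  have near1 : \forall x \near a, `|f a - f x| < 1.
    exact: (cvgrPdist_lt _ _).1 cf _ ltr01.
  have [d /= d0 Hd] := (nbhs_ballP _ _).1 near1.
  exists (1 + `|f a|), d; split=> // x xd.
  rewrite /taylor_poly big_ord0 subr0 expr0 mulr1.
  have /Hd : ball a d x by rewrite /ball /= distrC.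
  move=> /ltW h; rewrite -(subrK (f a) (f x)) (le_trans (ler_normD _ _)) //.
  by rewrite lerD2r distrC.
have [C [d [C0 d0 H]]] := IH f' Hf'.
pose e := Num.min d r.
have e0 : 0 < e by rewrite lt_min d0.
exists C, e; split=> // x xe.
pose h y := f y - taylor_poly k.+1 f a y.
have ha : h a = 0.
  rewrite /h /taylor_poly big_ord_recl /= expr0 mulr1 ?fact0 divr1.
  by rewrite big1 ?addr0 ?subrr // => i _; rewrite expr0n mulr0.
have Dh y : `|y - a| < e ->
    is_derive y 1 h (f' y - taylor_poly k f' a y).
  rewrite lt_min => /andP[yd yr].
  apply: is_deriveB; first exact: Df.
  rewrite /taylor_poly.
  under eq_fun do rewrite big_ord_recl /=.
  rewrite -[X in is_derive _ _ _ X]add0r.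
  apply: is_deriveD.
    by under eq_fun do rewrite expr0; exact: is_derive_cst.
  apply: is_derive_sum_apply => j.
  apply: is_derive_eq (is_derive_monomial _ _ _ _) _.
  rewrite -[_^`() a]/(derive1n j.+1 f a) (derive1nSr_near Df) ?subrr ?normr0 //.
  rewrite -[bump 0 j]/j.+1.
  have u0 : j.+1%:R != 0 :> R by rewrite pnatr_eq0.
  by rewrite factS natrM invfM -!mulrA [_^-1 * (j.+1%:R * _)]mulrCA mulKf.
rewrite -[f x - _]/(h x) -[h x]subr0 -ha exprSr mulrA.
apply: (is_derive_bound Dh xe) => y yx.
have ye : `|y - a| < e by exact: le_lt_trans xe.
apply: (le_trans (H y _)).
  by move: ye; rewrite lt_min => /andP[].
by rewrite ler_wpM2l ?(ltW C0) // lerXn2r ?nnegrE.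
Qed.

(** * Polynomials, power series and orders of vanishing *)

Lemma diff_times_horner a r n (p : {poly R}) : diff_times a r n (horner p).
Proof.
elim: n p => // n IH p; exists (horner p^`()); last exact: IH.
by move=> x _; exact: is_derive_poly.
Qed.

(* [(n+1) |x|^n (y - |x|) <= y^(n+1)] compares the derived series at [x] with the
   original one at some [y > |x|]. *)
Lemma is_cvg_pseries_diffs (c : R^nat) r :
  (forall x, `|x| < r -> cvgn (pseries c x)) ->
  forall x, `|x| < r -> cvgn (pseries (pseries_diffs c) x).
Proof.
move=> Hc x xr.
pose y := (2 * `|x| + r) / 3; pose z := (`|x| + 2 * r) / 3.
have x0 : 0 <= `|x| by [].
have xy : `|x| < y by rewrite /y; lra.
have y0 : 0 < y by exact: le_lt_trans xy.
have yz : y < z by rewrite /y /z; lra.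
have zr : z < r by rewrite /z; lra.
have z0 : 0 < z by exact: lt_trans yz.
have Cz : cvgn (pseries c z) by apply: Hc; rewrite gtr0_norm.
have Cy : cvgn (pseries (fun i => `|c i|) y).
  by apply: is_cvg_pseries_inside_norm Cz _; rewrite !gtr0_norm.
have Cy' : cvgn (series (fun i => (y - `|x|)^-1 * (`|c i.+1| * y ^+ i.+1))).
  have -> : (fun i => (y - `|x|)^-1 * (`|c i.+1| * y ^+ i.+1)) =
    (y - `|x|)^-1 *: (fun i => `|c i.+1| * y ^+ i.+1) by [].
  apply: is_cvg_seriesZ.
  have -> : series (fun i => `|c i.+1| * y ^+ i.+1) =
      (fun n => pseries (fun i => `|c i|) y n.+1 - `|c 0%N|).
    apply/funext => n; rewrite /pseries /series /= big_nat_recl //.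
    by rewrite expr0 mulr1 addrC addKr.
  apply: is_cvgB; last exact: is_cvg_cst.
  by move: Cy => /cvg_ex[s Hs]; apply/cvg_ex; exists s; rewrite cvg_shiftS.
apply: normed_cvg; apply: series_le_cvg Cy' => [n|n|n] //=.
  by rewrite !mulr_ge0 ?exprn_ge0 ?invr_ge0 ?subr_ge0 ?(ltW y0) ?(ltW xy).
rewrite /pseries_diffs !normrM normr_nat normrX [leLHS]mulrAC [leLHS]mulrC.
rewrite [leRHS]mulrCA ler_wpM2l // ler_pdivlMl ?subr_gt0 //.
have E := subrXX y `|x| n.+1.
apply: (@le_trans _ _ (y ^+ n.+1 - `|x| ^+ n.+1)); last first.
  by rewrite gerBl exprn_ge0.
rewrite E ler_wpM2l ?subr_ge0 ?(ltW xy) //.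
have -> : n.+1%:R * `|x| ^+ n = \sum_(i < n.+1) `|x| ^+ n.
  by rewrite sumr_const card_ord mulr_natl.
apply: ler_sum => i _.
have {1}-> : n = (n - i + i)%N by rewrite subnK // -ltnS.
by rewrite exprD /= ler_wpM2r ?exprn_ge0 // lerXn2r ?nnegrE ?(ltW xy) ?(ltW y0).
Qed.

Lemma diff_times_pseries n (c : R^nat) a r :
  (forall x, `|x| < r -> cvgn (pseries c x)) ->
  diff_times a r n (fun x => limn (pseries c (x - a))).
Proof.
elim: n c => // n IH c Hc.
have Hd := is_cvg_pseries_diffs Hc; have Hdd := is_cvg_pseries_diffs Hd.
exists (fun x => limn (pseries (pseries_diffs c) (x - a))); last exact: IH.
move=> x xr; pose K := (`|x - a| + r) / 2.
have x0 : 0 <= `|x - a| by [].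
have K0 : 0 <= K by rewrite /K; lra.
have Kr : `|K| < r by rewrite ger0_norm // /K; lra.
have xK : `|x - a| < `|K| by rewrite (ger0_norm K0) /K; lra.
have D1 := pseries_snd_diffs (Hc _ Kr) (Hd _ Kr) (Hdd _ Kr) xK.
have D2 : is_derive x 1 (fun y : R => y - a) 1.
  by apply: is_derive_eq; rewrite subr0.
by have := @is_derive1_comp R _ (fun y => y - a) x _ _ D1 D2; rewrite mulr1.
Qed.

Lemma analytic_diff_times f a : analytic_at f a ->
  exists2 r, 0 < r & forall n, diff_times a r n f.
Proof.
move=> [c [r [r0 H]]]; exists r => // n.
have E x : `|x - a| < r -> limn (pseries c (x - a)) = f x.
  by move=> /H h; apply: cvg_lim.
have Hc x : `|x| < r -> cvgn (pseries c x).
  move=> xr; have /H h : `|(x + a) - a| < r by rewrite addrK.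
  by rewrite addrK in h; apply/cvg_ex; eexists; exact: h.
case: n => // n; have [f' Df Hf'] := diff_times_pseries n.+1 a Hc.
exists f' => // x xr; apply: near_eq_is_derive (Df _ xr).
have e0 : 0 < r - `|x - a| by rewrite subr_gt0.
apply: filterS (nbhs_dist x e0) => y yx; apply: E.
rewrite -(subrK x y) -addrA (le_lt_trans (ler_normD _ _)) //.
by rewrite -ltrBrDr.
Qed.

(** The bound gives |c_0| <= D t for small t > 0, so c_0 = 0; the inequality can then be divided by
    t. *)
Lemma small_poly_coef0 k (c : nat -> R) (C delta : R) : 0 < delta ->
  (forall t, 0 < t < delta -> `|\sum_(j < k) c j * t ^+ j| <= C * t ^+ k) ->
  forall j, (j < k)%N -> c j = 0.
Proof.
elim: k c => // k IH c d0 H.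
have c0 : c 0%N = 0.
  apply/eqP; rewrite -normr_eq0; apply/eqP/le_anti; rewrite normr_ge0 andbT.
  pose D := `|C| + \sum_(j < k) `|c j.+1|.
  have D0 : 0 <= D by rewrite addr_ge0 ?sumr_ge0.
  have main t : 0 < t < delta -> t <= 1 -> `|c 0%N| <= D * t.
    move=> /andP[t0 td] t1.
    have := H t; rewrite t0 td => /(_ isT).
    rewrite big_ord_recl expr0 mulr1 => h.
    have -> : c 0%N = (c 0%N + \sum_(i < k) c (lift ord0 i) * t ^+ lift ord0 i)
      - \sum_(i < k) c (lift ord0 i) * t ^+ lift ord0 i by rewrite addrK.
    apply: le_trans (ler_normB _ _) _; rewrite /D mulrDl lerD //.
      apply: le_trans h _; apply: le_trans (_ : `|C| * t ^+ k.+1 <= _).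
        by rewrite ler_wpM2r ?exprn_ge0 ?(ltW t0) // ler_norm.
      rewrite ler_wpM2l // exprS -[leRHS]mulr1 ler_wpM2l ?(ltW t0) //.
      by rewrite exprn_ile1 // ltW.
    rewrite mulr_suml; apply: le_trans (ler_norm_sum _ _ _) _.
    apply: ler_sum => i _; rewrite normrM normrX (gtr0_norm t0) /=.
    rewrite ler_wpM2l // exprS -[leRHS]mulr1 ler_wpM2l ?(ltW t0) //.
    by rewrite exprn_ile1 // ltW.
  apply/ler_addgt0Pr => e e0; rewrite add0r.
  pose t := Num.min (Num.min (delta / 2) 1) (e / (D + 1)).
  have D1 : 0 < D + 1 by rewrite ltr_wpDl.
  have t0 : 0 < t by rewrite !lt_min ltr01 !divr_gt0.
  have tE : [/\ t <= delta / 2, t <= 1 & t <= e / (D + 1)].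
    by rewrite /t !ge_min !lexx !orbT.
  have [t1 t2 t3] := tE.
  apply: le_trans (main t _ t2) _; first by rewrite t0; lra.
  apply: (@le_trans _ _ ((D + 1) * t)).
    by rewrite ler_wpM2r ?(ltW t0) // lerDl.
  by rewrite mulrC -ler_pdivlMr.
move=> [//|j]; rewrite ltnS; apply: (IH (fun j => c j.+1)) => // t tt.
have := H t tt; rewrite big_ord_recl c0 mul0r add0r.
have /andP[t0 _] := tt.
have -> : \sum_(i < k) c (lift ord0 i) * t ^+ lift ord0 i =
    t * \sum_(i < k) c i.+1 * t ^+ i.
  by rewrite mulr_sumr; apply: eq_bigr => i _; rewrite exprS mulrCA.
by rewrite normrM (gtr0_norm t0) exprS mulrCA ler_pM2l.
Qed.

Lemma vanishing_bigO k f r : 0 < r -> diff_times 0 r k.+2 f -> vanishing k f ->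
  exists C delta : R, [/\ 0 < C, 0 < delta &
    forall t, `|t| < delta -> `|f t - f 0| <= C * `|t| ^+ k.+1].
Proof.
move=> r0 df vf; have [C [d [C0 d0 H]]] := taylor r0 df.
exists C, d; split=> // t; have := H t; rewrite subr0 => h /h.
rewrite /taylor_poly big_ord_recl big1 ?addr0 => [|i _].
  by rewrite /= expr0 mulr1 ?fact0 divr1.
by rewrite vf ?mul0r // lift0 /= ltn_ord.
Qed.

(** The Taylor remainder has the same order as f - f 0, so the Taylor polynomial without its
    constant term has degree at most k and is O(t^(k+1)). *)
Lemma bigO_vanishing k f r (C delta : R) : 0 < r -> diff_times 0 r k.+2 f ->
  0 < delta ->
  (forall t, 0 < t < delta -> `|f t - f 0| <= C * t ^+ k.+1) -> vanishing k f.
Proof.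
move=> r0 df d0 H.
have [D [d [D0 d'0 HD]]] := taylor r0 df.
(* The coefficient at 0 is set to 0 because f 0 is subtracted. *)
pose c j := if j == 0%N then 0 else derive1n j f 0 / j`!%:R.
have c0 j : (j < k.+1)%N -> c j = 0.
  apply: (@small_poly_coef0 k.+1 c (C + D) (Num.min delta d)).
    by rewrite lt_min d0.
  move=> t; rewrite lt_min => /and3P[t0 td td'].
  have -> : \sum_(j < k.+1) c j * t ^+ j = taylor_poly k.+1 f 0 t - f 0.
    rewrite /taylor_poly big_ord_recl [in RHS]big_ord_recl /= !expr0 ?fact0 divr1.
    rewrite !mulr1 (_ : c 0%N = 0) // add0r addrAC subrr add0r.
    by apply: eq_bigr => i _; rewrite subr0.
  have -> : taylor_poly k.+1 f 0 t - f 0 =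
    (f t - f 0) - (f t - taylor_poly k.+1 f 0 t) by ring.
  apply: le_trans (ler_normB _ _) _; rewrite mulrDl lerD //.
    by apply: H; rewrite t0.
  by have := HD t; rewrite subr0 gtr0_norm //; exact.
move=> m /andP[m1 mk]; have := c0 m mk; rewrite /c -[m == 0%N]negbK -lt0n m1 /=.
move=> /eqP; rewrite mulf_eq0 invr_eq0 pnatr_eq0 -[m`! == 0%N]negbK -lt0n.
by rewrite fact_gt0 orbF => /eqP.
Qed.

End Calculus.

(** * Edge lengths as a quadratic map *)

Section MatrixNorm.
Context {R : realType}.

Lemma mx_norm_ge m n (x : 'M[R]_(m, n)) i j : `|x i j| <= `|x|.
Proof.
by rewrite [leRHS]/Num.Def.normr /= mx_normrE; apply/bigmax_geP; right; exists (i, j).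
Qed.

Lemma mx_norm_le m n (x : 'M[R]_(m, n)) (b : R) : 0 <= b ->
  (forall i j, `|x i j| <= b) -> `|x| <= b.
Proof.
by move=> b0 H; rewrite [leLHS]/Num.Def.normr /= mx_normrE; apply/bigmax_leP; split.
Qed.

Lemma lin_mxE m n (a : R) (A B : 'M[R]_(m, n)) i j :
  (a *: A + B) i j = a * A i j + B i j.
Proof. by rewrite !mxE. Qed.

Lemma linear_mx_bounded m n (W : normedModType R) (f : {linear 'M[R]_(m, n) -> W}) :
  exists2 C : R, 0 <= C & forall x, `|f x| <= C * `|x|.
Proof.
exists (\sum_(i < m) \sum_(j < n) `|f (delta_mx i j)|).
  by apply: sumr_ge0 => i _; apply: sumr_ge0.
move=> x; rewrite [in leLHS](matrix_sum_delta x) linear_sum mulr_suml.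
apply: le_trans (ler_norm_sum _ _ _) _; apply: ler_sum => i _.
rewrite linear_sum mulr_suml.
apply: le_trans (ler_norm_sum _ _ _) _; apply: ler_sum => j _.
by rewrite linearZ normrZ mulrC ler_wpM2l // mx_norm_ge.
Qed.

Lemma le_norm_cnorm n d (x : 'M[R]_(n, d)) : `|x| <= cnorm x.
Proof.
apply: mx_norm_le; first exact: sqrtr_ge0.
move=> i k; rewrite -sqrtr_sqr ler_wsqrtr // (bigD1 i) //= (bigD1 k) //= -addrA.
rewrite lerDl addr_ge0 ?sumr_ge0 // => [j _|j _]; first exact: sqr_ge0.
by apply: sumr_ge0 => ? _; exact: sqr_ge0.
Qed.

Lemma cnorm_le_norm n d : exists2 K : R, 0 < K &
  forall x : 'M[R]_(n, d), cnorm x <= K * `|x|.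
Proof.
exists (1 + (n * d)%:R); first by rewrite ltr_pwDl.
move=> x; have N0 : 0 <= `|x| by [].
have K0 : 0 <= 1 + (n * d)%:R :> R by rewrite addr_ge0.
rewrite -(ger0_norm (mulr_ge0 K0 N0)) -sqrtr_sqr ler_wsqrtr // exprMn.
apply: (@le_trans _ _ ((n * d)%:R * `|x| ^+ 2)).
  have sumE m (b : R) : m%:R * b = \sum_(i < m) b.
    by rewrite sumr_const card_ord mulr_natl.
  rewrite natrM -mulrA sumE; apply: ler_sum => i _; rewrite sumE.
  apply: ler_sum => k _; rewrite -real_normK ?num_real //.
  by rewrite lerXn2r ?nnegrE ?mx_norm_ge.
rewrite ler_wpM2r ?exprn_ge0 //.
have : 0 <= (n * d)%:R :> R by [].
by set N := _%:R; nra.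
Qed.

End MatrixNorm.

Section Edges.
Context {R : realType} {n d : nat}.
Variables (G : rel 'I_n) (l : nat) (p : 'M[R]_(n, d)).
Implicit Types x y : 'M[R]_(n, d).

Definition bar x y (i j : 'I_n) : R :=
  dotp (row i x - row j x) (row i y - row j y).

Lemma barE x y i j : bar x y i j = \sum_(k < d) (x i k - x j k) * (y i k - y j k).
Proof. by apply: eq_bigr => k _; rewrite !mxE. Qed.

Lemma barDr x y z i j (a : R) : bar x (a *: y + z) i j = a * bar x y i j + bar x z i j.
Proof.
rewrite !barE mulr_sumr -big_split; apply: eq_bigr => k _ /=.
by rewrite !mxE; ring.
Qed.

Lemma barC x y i j : bar x y i j = bar y x i j.
Proof. by rewrite !barE; apply: eq_bigr => k _; rewrite mulrC. Qed.

Lemma bar_bounded x y i j : `|bar x y i j| <= 4 * d%:R * `|x| * `|y|.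
Proof.
rewrite barE; apply: le_trans (ler_norm_sum _ _ _) _.
have -> : 4 * d%:R * `|x| * `|y| = \sum_(k < d) (2 * `|x|) * (2 * `|y|).
  by rewrite sumr_const card_ord -mulr_natl; ring.
have diff2 (z : 'M[R]_(n, d)) u w h : `|z u h - z w h| <= 2 * `|z|.
  apply: le_trans (ler_normB _ _) _; rewrite mulr_natl mulr2n.
  by rewrite lerD ?mx_norm_ge.
by apply: ler_sum => h _; rewrite normrM ler_pM ?diff2.
Qed.

Definition edge_mx (f : 'I_n -> 'I_n -> R) (x : 'M[R]_(n, d)) : 'M[R]_(n, n + d) :=
  row_mx (\matrix_(i, j) (if G i j then f i j else 0))
    (\matrix_(i, k) (if (i <= l)%N && (i <= k)%N then x i k else 0)).

(* The pinning conditions are appended to the edge equations, so that pinned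
   configurations need not be handled as a separate subspace. *)
Definition edge_lin x : 'M[R]_(n, n + d) :=
  edge_mx (fun i j => 2 * bar p x i j) x.

(** The pinning equations are linear, so their block has no quadratic part. *)
Definition edge_quad x y : 'M[R]_(n, n + d) := edge_mx (bar x y) 0.

Lemma edge_mxl f x i j : edge_mx f x i (lshift d j) = if G i j then f i j else 0.
Proof. by rewrite row_mxEl mxE. Qed.

Lemma edge_mxr f x i k :
  edge_mx f x i (rshift n k) = if (i <= l)%N && (i <= k)%N then x i k else 0.
Proof. by rewrite row_mxEr mxE. Qed.

Lemma edge_mxP (A B : 'M[R]_(n, n + d)) :
  (forall i j, A i (lshift d j) = B i (lshift d j)) ->
  (forall i k, A i (rshift n k) = B i (rshift n k)) -> A = B.
Proof.
by move=> H1 H2; apply/matrixP => i j; case: (split_ordP j) => k ->.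
Qed.

Fact edge_lin_linear : linear edge_lin.
Proof.
move=> a x y; apply: edge_mxP => i j.
  by rewrite lin_mxE !edge_mxl barDr; case: ifP => _; ring.
by rewrite lin_mxE !edge_mxr lin_mxE; case: ifP => _; ring.
Qed.
HB.instance Definition _ :=
  GRing.isLinear.Build R _ _ _ edge_lin edge_lin_linear.

Fact edge_quad_bilinear : bilinear_for *:%R *:%R edge_quad.
Proof.
split=> [u|u] a x y; apply: edge_mxP => i j /=;
  rewrite lin_mxE ?(edge_mxl, edge_mxr) ?mxE.
- by rewrite ![bar _ u _ _]barC barDr; case: ifP => _; ring.
- by case: ifP => _; ring.
- by rewrite barDr; case: ifP => _; ring.
- by case: ifP => _; ring.
Qed.
HB.instance Definition _ :=
  bilinear_isBilinear.Build R _ _ _ _ _ edge_quad edge_quad_bilinear.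

End Edges.

(* Registers the join of the complete and normed-module structures. *)
HB.instance Definition _ (R : realType) (n d : nat) :=
  Complete.copy 'M[R]_(n, d) 'M[R]_(n, d).

Definition mx_entry {R : realType} {n d : nat} (i : 'I_n) (k : 'I_d)
  (x : 'M[R]_(n, d)) : R := x i k.

Fact mx_entry_scalar {R : realType} {n d : nat} (i : 'I_n) (k : 'I_d) :
  scalar (@mx_entry R n d i k).
Proof. by move=> a x y; rewrite /mx_entry lin_mxE. Qed.
HB.instance Definition _ {R : realType} {n d : nat} (i : 'I_n) (k : 'I_d) :=
  GRing.isLinear.Build R _ _ _ (@mx_entry R n d i k) (mx_entry_scalar i k).

(** * The framework equations in the abstract setting *)

Section Reduction.
Context {R : realType} {n d : nat}.
Variables (G : rel 'I_n) (l : nat) (p : 'M[R]_(n, d)).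
Implicit Types x y v : 'M[R]_(n, d).

Definition edge_map x : 'M[R]_(n, n + d) :=
  quad (edge_lin G l p) (edge_quad G l) x.

Lemma sqdistD x i j :
  sqdist (p + x) i j = sqdist p i j + 2 * bar p x i j + bar x x i j.
Proof.
rewrite -[sqdist (p + x) i j]/(bar (p + x) (p + x) i j).
rewrite -[sqdist p i j]/(bar p p i j) !barE mulr_sumr -!big_split.
by apply: eq_bigr => k _ /=; rewrite !mxE; ring.
Qed.

Lemma edge_mapl x i j : edge_map x i (lshift d j) =
  if G i j then sqdist (p + x) i j - sqdist p i j else 0.
Proof.
rewrite /edge_map /quad mxE !edge_mxl sqdistD.
by case: ifP => _; ring.
Qed.

Lemma edge_mapr x i k : edge_map x i (rshift n k) =
  if (i <= l)%N && (i <= k)%N then x i k else 0.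
Proof. by rewrite /edge_map /quad mxE !edge_mxr mxE if_same addr0. Qed.

Lemma pinned_posP x :
  pinned_pos l x <-> forall i k, edge_map x i (rshift n k) = 0.
Proof.
split=> [px i k|H i k il ik].
  by rewrite edge_mapr; case: ifP => // /andP[il ik]; exact: px.
by have := H i k; rewrite edge_mapr il ik.
Qed.

Lemma edge_lin_eq0 x : edge_lin G l p x = 0 <-> inK G l p x.
Proof.
split=> [H|[px H]].
  split=> [i k il ik|i j Gij].
    by have /matrixP/(_ i (rshift n k)) := H; rewrite edge_mxr il ik mxE.
  have /matrixP/(_ i (lshift d j)) := H; rewrite edge_mxl Gij mxE => /eqP.
  by rewrite mulf_eq0 pnatr_eq0 /= => /eqP.
apply: edge_mxP => i j; rewrite ?edge_mxl ?edge_mxr mxE; case: ifP => //.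
  by move=> /H; rewrite -/(bar _ _ _ _) => ->; rewrite mulr0.
by move=> /andP[il ij]; exact: px.
Qed.

Lemma edge_quad_bounded : exists2 C : R, 0 <= C &
  forall x y, `|edge_quad G l x y| <= C * `|x| * `|y|.
Proof.
exists (4 * d%:R); first by rewrite mulr_ge0.
move=> x y; have pos : 0 <= 4 * d%:R * `|x| * `|y| by rewrite !mulr_ge0.
apply: mx_norm_le => // i j; case: (split_ordP j) => k ->.
  rewrite edge_mxl; case: ifP => _; last by rewrite normr0.
  exact: bar_bounded.
by rewrite edge_mxr mxE if_same normr0.
Qed.

(** This is all that later arguments retain of the formal branch: a nonzero velocity, pinned
    coefficients and the order of F. *)
Definition slow_branch (m : nat) := exists z : nat -> 'M[R]_(n, d),
  [/\ z 0%N != 0, forall i, (i <= m)%N -> pinned_pos l (z i) &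
    exists2 D : R, 0 < D & forall t : R, `|t| <= 1 ->
      `|edge_map (\sum_(0 <= i < m.+1) t ^+ i.+1 *: z i)| <= D * `|t| ^+ m.+2].

Definition edge_lower_bound (k : nat) := exists c delta : R,
  [/\ 0 < c, 0 < delta &
    forall x, `|x| < delta -> c * `|x| ^+ k <= `|edge_map x|].

Section KernelInverse.
Variables (T : 'Hom('M[R]_(n, n + d), 'M[R]_(n, d))) (v : 'M[R]_(n, d)).
Variables (i0 : 'I_n) (k0 : 'I_d).

(** When entry [(i0, k0)] of [v] is 1, the correction moves the image of [T] into the kernel of that
    entry and changes [T] only along [v]. *)
Definition kernel_inverse (y : 'M[R]_(n, n + d)) : 'M[R]_(n, d) :=
  T y - T y i0 k0 *: v.

Fact kernel_inverse_linear : linear kernel_inverse.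
Proof.
move=> a x y; rewrite /kernel_inverse linearP lin_mxE scalerDl scalerBr scalerA.
by rewrite opprD addrACA.
Qed.
HB.instance Definition _ :=
  GRing.isLinear.Build R _ _ _ kernel_inverse kernel_inverse_linear.
End KernelInverse.

(** The cases are: all obstructions vanish, or there is a least index m with a nonzero one, which
    governs both the branch and the lower bound. *)
Lemma edge_map_alternative : dimK1 G l p ->
  ((forall m, slow_branch m) /\
    forall e : R, 0 < e -> exists x, [/\ x <> 0, `|x| < e & edge_map x = 0]) \/
  (exists m, slow_branch m /\ edge_lower_bound m.+2).
Proof.
move=> [v0 [Kv0 v0n0 Kspan]].
have [[i0 k0] v0ik] : exists ik, v0 ik.1 ik.2 != 0.
  apply/existsP; apply: contra_neqT v0n0; rewrite negb_exists => /forallP H.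
  by apply/matrixP => i k; have := H (i, k); rewrite negbK mxE => /eqP.
rewrite /= in v0ik.
pose v := (v0 i0 k0)^-1 *: v0.
have vik : v i0 k0 = 1 by rewrite mxE mulVf.
have Lv : edge_lin G l p v = 0.
  by rewrite linearZ /= (edge_lin_eq0 v0).2 // scaler0.
have span x : edge_lin G l p x = 0 -> exists c : R, x = c *: v.
  move=> /edge_lin_eq0/Kspan[c ->]; exists (c * v0 i0 k0).
  by rewrite scalerA mulfK.
pose T := linfun (edge_lin G l p).
pose S : {linear 'M[R]_(n, n + d) -> 'M[R]_(n, d)} :=
  kernel_inverse (T^-1)%VF v i0 k0.
pose phi : {scalar 'M[R]_(n, d)} := mx_entry i0 k0.
have phiv : phi v = 1 by exact: vik.
have phiS (y : 'M[R]_(n, n + d)) : phi (S y) = 0.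
  rewrite /phi /S /= /mx_entry /kernel_inverse -scaleN1r addrC lin_mxE.
  by rewrite mxE vik; ring.
have SL x : S (edge_lin G l p x) = x - phi x *: v.
  (* [T^-1] is a right inverse of [T] on its image, so [T^-1] of L x differs from x by an element of
     ker L. *)
  have [c Ec] : exists c : R, (T^-1)%VF (edge_lin G l p x) - x = c *: v.
    apply: span; rewrite linearB /= -!(lfunE (edge_lin G l p)) -/T.
    by rewrite limg_lfunVK ?subrr // memv_img ?memvf.
  have {}Ec : (T^-1)%VF (edge_lin G l p x) = c *: v + x by rewrite -Ec subrK.
  rewrite /S /phi /= /mx_entry /kernel_inverse Ec.
  by rewrite lin_mxE vik mulr1 scalerDl opprD addrACA subrr add0r.
have [CL CL0 HL] := linear_mx_bounded (edge_lin G l p).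
have [CS CS0 HS] := linear_mx_bounded S.
have [CB CB0 HB] := edge_quad_bounded.
pose C := 1 + CL + CS + CB.
have C1 : 1 <= C by rewrite /C; lra.
have HL' x : `|edge_lin G l p x| <= C * `|x|.
  by apply: le_trans (HL _) _; rewrite ler_wpM2r // /C; lra.
have HS' (x : 'M[R]_(n, n + d)) : `|S x| <= C * `|x|.
  by apply: le_trans (HS _) _; rewrite ler_wpM2r // /C; lra.
have Hphi x : `|phi x| <= C * `|x|.
  by apply: le_trans (mx_norm_ge _ _ _) _; rewrite ler_peMl.
have HB' x y : `|edge_quad G l x y| <= C * `|x| * `|y|.
  by apply: le_trans (HB _ _) _; rewrite !ler_wpM2r // /C; lra.
pose ob := obstruction (edge_lin G l p) (edge_quad G l) S v.
pose z := ls_coef (edge_quad G l) S v.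
(* The pinning block of the convolution is zero. If [ob i] vanishes, the same block of L S of it is
   zero, which says that the coefficient of index i + 1 is pinned. Hence pinning is known up to
   index m only. *)
have pin m : (forall i, (i < m)%N -> ob i = 0) ->
    forall i, (i <= m)%N -> pinned_pos l (z i).
  move=> ob0 [|i] im.
    have [] // := (edge_lin_eq0 v).1 Lv.
  move=> u k ul uk; rewrite /z ls_coefS -scaleN1r.
  have /subr0_eq/matrixP/(_ u (rshift n k)) := ob0 i im.
  rewrite edge_mxr ifT ?ul ?uk //; set w := S _ => wE.
  rewrite [LHS]mxE -wE /ls_conv summxE big1 ?mulr0 // => h _.
  by rewrite edge_mxr mxE if_same.
have branch m : (forall i, (i < m)%N -> ob i = 0) -> slow_branch m.
  move=> ob0; exists z; split; [|exact: pin|].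
    rewrite /z ls_coef0; apply/eqP => v0'; move: vik; rewrite v0' mxE => /eqP.
    by rewrite eq_sym oner_eq0.
  exact: (@quad_ls_branch_small _ _ _ _ _ S v Lv m ob0).
have [all0|] := pselect (forall m, ob m = 0).
  left; split=> [m|]; first by apply: branch.
  exact: (quad_zeros Lv phiv phiS C1 HL' HS' Hphi HB' all0).
move=> /existsNP[m0 obm0]; right.
have ex : exists m, `[< ob m <> 0 >] by exists m0; apply/asboolP.
case: (ex_minnP ex) => m /asboolP obm mmin.
have ob0 i : (i < m)%N -> ob i = 0.
  move=> im; apply: contrapT => obi.
  by have := mmin i (asboolT obi); rewrite leqNgt im.
exists m; split; first exact: branch.
exact: (quad_lower_bound Lv phiv phiS SL C1 HL' HS' Hphi HB' ob0 obm).
Qed.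

End Reduction.

(** * Stiff-bar energies *)

(** Monotonicity in the constant allows the largest constant and the smallest radius over the finite
    index set. *)
Lemma fin_uniform_bound (R : realType) (I : finType) (T : Type) (N : T -> R)
    (P : I -> R -> T -> Prop) :
  (forall i x (C C' : R), 0 < C -> C <= C' -> P i C x -> P i C' x) ->
  (forall i, exists C delta : R, [/\ 0 < C, 0 < delta &
    forall x, N x < delta -> P i C x]) ->
  exists C delta : R, [/\ 0 < C, 0 < delta &
    forall i x, N x < delta -> P i C x].
Proof.
move=> mono H.
suff [C [e [C0 e0 HC]]] : exists C delta : R, [/\ 0 < C, 0 < delta &
    forall i x, i \in enum I -> N x < delta -> P i C x].
  by exists C, e; split=> // i x; apply: HC; rewrite mem_enum.
elim: (enum I) => [|i s [C [e [C0 e0 IH]]]]; first by exists 1, 1.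
have [C' [e' [C'0 e'0 H']]] := H i.
exists (Num.max C C'), (Num.min e e'); split.
- by rewrite lt_max C0.
- by rewrite lt_min e0.
- move=> j x; rewrite inE lt_min => /orP[/eqP-> |js] /andP[xe xe'].
    by apply: mono (H' _ xe') => //; rewrite le_max lexx orbT.
  by apply: mono (IH _ _ js xe) => //; rewrite le_max lexx.
Qed.

Lemma taylor_poly3 (R : realType) (f : R -> R) (a x : R) :
  taylor_poly 3 f a x =
  f a + derive1n 1 f a * (x - a) + derive1n 2 f a / 2 * (x - a) ^+ 2.
Proof.
rewrite /taylor_poly !big_ord_recr big_ord0 /= add0r expr0 mulr1 expr1.
by rewrite ?(fact0, factS) !muln1 !divr1.
Qed.

(** At the minimum the first derivative vanishes, so f x - f a = b h^2 + O(h^3) with b half the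
    second derivative. Within the chosen radius the cubic error is at most b h^2 / 2. The constant
    adds 2/b and 2b to serve both inequalities. *)
Lemma strict_min_quadratic (R : realType) (f : R -> R) (a : R) :
  analytic_at f a ->
  (exists r : R, 0 < r /\ forall x, 0 < `|x - a| < r -> f a < f x) ->
  0 < derive1n 2 f a ->
  exists C delta : R, [/\ 0 < C, 0 < delta & forall x, `|x - a| < delta ->
    (x - a) ^+ 2 <= C * (f x - f a) /\ f x - f a <= C * (x - a) ^+ 2].
Proof.
move=> /analytic_diff_times[r r0 df] [s [s0 fmin]] f2.
have [D [e [D0 e0 H]]] := taylor r0 (df 4%N).
have f1 : derive1n 1 f a = 0.
  pose u := Num.min r s.
  have u0 : 0 < u by rewrite lt_min r0.
  have dist_u t : t \in `]a - u, a + u[%R -> `|t - a| < u.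
    by rewrite in_itv /= ltr_norml => /andP[h1 h2]; apply/andP; split; lra.
  have [] : is_derive a 1 f 0; last by rewrite derive1n1 derive1E.
  apply: (@derive1_at_min R f (a - u) (a + u)); first by lra.
  - move=> t /dist_u; rewrite lt_min => /andP[tr _].
    by have [f' /(_ _ tr)[]] := df 1%N.
  - by rewrite in_itv /=; apply/andP; split; lra.
  - move=> t /dist_u; rewrite lt_min => /andP[_ ts].
    have [->//|ta] := eqVneq t a.
    by apply/ltW/fmin; rewrite ts normr_gt0 subr_eq0 ta.
pose b := derive1n 2 f a / 2.
have b0 : 0 < b by rewrite divr_gt0.
exists (2 / b + 2 * b), (Num.min e (b / (2 * D))); split.
- by rewrite addr_gt0 ?divr_gt0 ?mulr_gt0.
- by rewrite lt_min e0 divr_gt0 ?mulr_gt0.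
move=> x; rewrite lt_min => /andP[xe]; rewrite ltr_pdivlMr ?mulr_gt0 // => xb.
have := H x xe; rewrite taylor_poly3 f1 mul0r addr0 -/b.
set h := x - a; set y := f x - f a => HT.
have hE : `|h| ^+ 2 = h ^+ 2 by rewrite real_normK ?num_real.
have h2 : 0 <= h ^+ 2 by exact: sqr_ge0.
have h3 : D * `|h| ^+ 3 <= b / 2 * h ^+ 2.
  rewrite exprS hE mulrA ler_wpM2r //.
  by rewrite -/h in xb; lra.
have {HT} : `|y - b * h ^+ 2| <= b / 2 * h ^+ 2.
  by apply: le_trans h3; apply: le_trans HT; rewrite opprD addrA.
rewrite ler_norml => /andP[l1 l2].
have y0 : b / 2 * h ^+ 2 <= y by lra.
have y1 : 0 <= y by apply: le_trans y0; rewrite mulr_ge0 // divr_ge0 // ltW.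
split.
  apply: (@le_trans _ _ (2 / b * y)).
    by rewrite mulrAC ler_pdivlMr //; lra.
  by rewrite ler_wpM2r // lerDl mulr_ge0 // ltW.
apply: (@le_trans _ _ (2 * b * h ^+ 2)).
  have : 0 <= b * h ^+ 2 by rewrite mulr_ge0 // ltW.
  by lra.
by rewrite ler_wpM2r // lerDr divr_ge0 // ltW.
Qed.

Section Energy.
Context {R : realType} {n d : nat}.
Variables (G : rel 'I_n) (l : nat) (p : 'M[R]_(n, d)).
Implicit Types x y q : 'M[R]_(n, d).
Hypothesis Fp : framework G p.

Lemma sqdist_ge0 q i j : 0 <= sqdist q i j.
Proof. by apply: sumr_ge0 => k _; exact: sqr_ge0. Qed.

Lemma sqdistC q i j : sqdist q i j = sqdist q j i.
Proof.
rewrite -[LHS]/(bar q q i j) -[RHS]/(bar q q j i) !barE.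
by apply: eq_bigr => k _; ring.
Qed.

Lemma sqr_dist q i j : dist q i j ^+ 2 = sqdist q i j.
Proof. by rewrite sqr_sqrtr ?sqdist_ge0. Qed.

Lemma dist_gt0 i j : G i j -> 0 < dist p i j.
Proof.
move=> Gij; rewrite sqrtr_gt0 lt_neqAle sqdist_ge0 andbT eq_sym.
apply/eqP => s0; have [_ /(_ _ _ Gij) /eqP []] := Fp.
apply/rowP => k; apply/eqP; rewrite -subr_eq0 -sqrf_eq0.
have := s0; rewrite -[sqdist _ _ _]/(bar p p i j) barE => /eqP.
rewrite psumr_eq0 => [/allP/(_ k)|h _]; last exact: sqr_ge0.
by rewrite mem_index_enum => /(_ isT); rewrite !mxE.
Qed.

Lemma sqdist_near : exists2 M : R, 0 < M & forall x i j, `|x| <= 1 ->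
  `|sqdist (p + x) i j - sqdist p i j| <= M * `|x|.
Proof.
exists (8 * d%:R * `|p| + 4 * d%:R + 1).
  by rewrite ltr_wpDl // addr_ge0 // ?mulr_ge0.
move=> x i j x1; rewrite sqdistD.
have -> : sqdist p i j + 2 * bar p x i j + bar x x i j - sqdist p i j =
  2 * bar p x i j + bar x x i j by ring.
apply: le_trans (ler_normD _ _) _; rewrite normrM normr_nat.
have b1 := bar_bounded p x i j; have b2 := bar_bounded x x i j.
have b3 : 4 * d%:R * `|x| * `|x| <= 4 * d%:R * `|x|.
  by rewrite ler_piMr // !mulr_ge0.
have x0 : 0 <= `|x| by [].
lra.
Qed.

(** With h the change of length and s the original one, D = h (q + s), and q + s lies between s and
    2 s + 1 once |h| < 1. The positivity of s makes D and h comparable. *)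
Lemma edge_energy_bounds (e : R -> R) i j : G i j ->
  analytic_at e (dist p i j) ->
  (exists r : R, 0 < r /\
    forall t, 0 < `|t - dist p i j| < r -> e (dist p i j) < e t) ->
  0 < derive1n 2 e (dist p i j) ->
  exists C delta : R, [/\ 0 < C, 0 < delta & forall x, `|x| < delta ->
    let D := sqdist (p + x) i j - sqdist p i j in
    let W := e (dist (p + x) i j) - e (dist p i j) in
    D ^+ 2 <= C * W /\ W <= C * D ^+ 2].
Proof.
move=> Gij an mn e2; have [C [r [C0 r0 H]]] := strict_min_quadratic an mn e2.
have s0 := dist_gt0 Gij; set s := dist p i j in an mn e2 H s0 *.
have [M M0 HM] := sqdist_near.
pose K := (2 * s + 1) ^+ 2; pose J := (s ^+ 2)^-1.
have K0 : 0 < K by rewrite exprn_gt0 // addr_gt0 // mulr_gt0.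
have J0 : 0 < J by rewrite invr_gt0 exprn_gt0.
(* The radius comes from s |h| <= |D| <= M |x|, which forces |h| below both r and 1. *)
exists (C * (K + J)), (Num.min 1 (s * Num.min r 1 / M)); split.
- by rewrite mulr_gt0 // addr_gt0.
- by rewrite lt_min ltr01 divr_gt0 // mulr_gt0 // lt_min r0 ltr01.
move=> x; rewrite lt_min => /andP[x1]; rewrite ltr_pdivlMr // => xM.
set D := _ - _; set W := _ - _.
set q := dist (p + x) i j in W *.
have q0 : 0 <= q by exact: sqrtr_ge0.
pose h := q - s.
have DE : D = h * (q + s) by rewrite /D -!sqr_dist -/q -/s /h; ring.
have hD : `|h| * s <= `|D|.
  by rewrite DE normrM ler_wpM2l // ger0_norm ?addr_ge0 ?(ltW s0) // lerDr.
have : `|h| < Num.min r 1.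
  rewrite -(ltr_pM2l s0); apply: le_lt_trans xM.
  rewrite mulrC; apply: le_trans hD _; rewrite [leRHS]mulrC.
  exact: HM (ltW x1).
rewrite lt_min => /andP[hr h1].
have [H1 H2] := H _ hr; rewrite -/W -/h in H1 H2.
have h2 : 0 <= h ^+ 2 by exact: sqr_ge0.
have W0 : 0 <= W by rewrite -(pmulr_rge0 _ C0); exact: le_trans H1.
have D1 : D ^+ 2 <= K * h ^+ 2.
  rewrite DE exprMn mulrC ler_wpM2r // lerXn2r ?nnegrE ?addr_ge0 ?mulr_ge0 ?(ltW s0) //.
  by move: h1; rewrite /h ltr_norml => /andP[_]; lra.
have D2 : h ^+ 2 <= J * D ^+ 2.
  rewrite ler_pdivlMl ?exprn_gt0 // DE exprMn mulrC ler_wpM2l //.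
  by rewrite lerXn2r ?nnegrE ?addr_ge0 ?(ltW s0) // lerDr.
have DD : 0 <= D ^+ 2 by exact: sqr_ge0.
split=> /=.
  apply: le_trans D1 _; apply: (@le_trans _ _ (K * (C * W))).
    by rewrite ler_wpM2l // ltW.
  by rewrite mulrA [K * C]mulrC ler_wpM2r // ler_wpM2l ?(ltW C0) // lerDl ltW.
apply: le_trans H2 _; apply: (@le_trans _ _ (C * (J * D ^+ 2))).
  by rewrite ler_wpM2l // ltW.
by rewrite mulrA ler_wpM2r // ler_wpM2l ?(ltW C0) // lerDr ltW.
Qed.

(** Every edge term is nonnegative near p, so each is at most the total; conversely the total is at
    most n^2 times the largest entry bound. *)
Lemma energy_bounds Eb : stiff_bar G p Eb ->
  exists C delta : R, [/\ 0 < C, 0 < delta & forall x,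
    pinned_pos l x -> `|x| < delta ->
    let W := energy G Eb (p + x) - energy G Eb p in
    `|edge_map G l p x| ^+ 2 <= C * W /\ W <= C * `|edge_map G l p x| ^+ 2].
Proof.
move=> sb.
pose D x i j := sqdist (p + x) i j - sqdist p i j.
pose W x i j := Eb i j (dist (p + x) i j) - Eb i j (dist p i j).
have [] := @fin_uniform_bound R ('I_n * 'I_n)%type 'M[R]_(n, d) (fun x => `|x|)
  (fun ij C x => G ij.1 ij.2 -> (ij.1 < ij.2)%N ->
    D x ij.1 ij.2 ^+ 2 <= C * W x ij.1 ij.2 /\
    W x ij.1 ij.2 <= C * D x ij.1 ij.2 ^+ 2).
- move=> [i j] x C C' C0 CC' /= H Gij ij; have [H1 H2] := H Gij ij.
  have D0 : 0 <= D x i j ^+ 2 by exact: sqr_ge0.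
  have W0 : 0 <= W x i j by rewrite -(pmulr_rge0 _ C0); exact: le_trans H1.
  by split; [apply: le_trans H1 _|apply: le_trans H2 _]; rewrite ler_wpM2r.
- move=> [i j] /=; case: (boolP (G i j && (i < j)%N)); last first.
    by move=> /negP nG; exists 1, 1; split=> // x _ Gij ij; case: nG; rewrite Gij ij.
  move=> /andP[Gij ij]; have [an mn e2] := sb _ _ Gij ij.
  have [C [e [C0 e0 H]]] := edge_energy_bounds Gij an mn e2.
  by exists C, e; split=> // x xe _ _; exact: H.
move=> C [e [C0 e0 H]].
exists (C + (n * n)%:R * C), e; split=> //.
  by rewrite ltr_pwDl // mulr_ge0 // ltW.
move=> x px xe; set Z := energy _ _ _ - _.
have ZE : Z = \sum_(i < n) \sum_(j < n | G i j && (i < j)%N) W x i j.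
  rewrite /Z /energy -sumrB; apply: eq_bigr => i _; rewrite -sumrB.
  by apply: eq_bigr.
have HH i j : G i j -> (i < j)%N ->
    [/\ 0 <= W x i j, D x i j ^+ 2 <= C * W x i j & W x i j <= C * D x i j ^+ 2].
  move=> Gij ij; have [H1 H2] := H (i, j) x xe Gij ij; split=> //.
  by rewrite -(pmulr_rge0 _ C0); apply: le_trans H1; exact: sqr_ge0.
have W0 i : 0 <= \sum_(j < n | G i j && (i < j)%N) W x i j.
  by apply: sumr_ge0 => j /andP[Gij ij]; have [] := HH _ _ Gij ij.
have Z0 : 0 <= Z by rewrite ZE sumr_ge0.
have WZ i j : G i j -> (i < j)%N -> W x i j <= Z.
  move=> Gij ij; rewrite ZE (bigD1 i) //= (bigD1 j) /= ?Gij //.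
  rewrite -addrA lerDl addr_ge0 ?sumr_ge0 // => k /andP[/andP[Gik ik] _].
  by have [] := HH _ _ Gik ik.
have CZ : 0 <= C * Z by rewrite mulr_ge0 // ltW.
have DZ i j : G i j -> (i < j)%N -> `|D x i j| <= Num.sqrt (C * Z).
  move=> Gij ij; rewrite -sqrtr_sqr ler_wsqrtr //.
  have [_ h _] := HH _ _ Gij ij; apply: le_trans h _.
  by rewrite ler_wpM2l ?(ltW C0) // WZ.
split=> /=.
  apply: (@le_trans _ _ (C * Z)); last first.
    by rewrite ler_wpM2r // lerDl mulr_ge0 // ltW.
  rewrite -[leRHS]sqr_sqrtr // lerXn2r ?nnegrE ?sqrtr_ge0 //.
  apply: mx_norm_le; first exact: sqrtr_ge0.
  move=> i j; case: (split_ordP j) => k ->; last first.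
    by rewrite ((pinned_posP G l p x).1 px) normr0 sqrtr_ge0.
  rewrite edge_mapl; case: ifP => [Gik|_]; last by rewrite normr0 sqrtr_ge0.
  (* The energy runs over i < j, while [edge_map] lists each edge in both orders. *)
  have [[Gsym Girr] _] := Fp.
  case: (ltngtP i k) => [ik|ki|/ord_inj ik].
  - exact: DZ.
  - rewrite sqdistC [sqdist p i k]sqdistC; apply: DZ => //.
    by rewrite Gsym.
  - by move: Gik; rewrite ik (negPf (Girr _)).
apply: (@le_trans _ _ ((n * n)%:R * C * `|edge_map G l p x| ^+ 2)); last first.
  by rewrite ler_wpM2r ?exprn_ge0 // lerDr ltW.
have sumE m (b : R) : m%:R * b = \sum_(i < m) b.
  by rewrite sumr_const card_ord mulr_natl.
have F0 : 0 <= C * `|edge_map G l p x| ^+ 2.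
  by rewrite mulr_ge0 ?exprn_ge0 // ltW.
rewrite ZE natrM -!mulrA sumE; apply: ler_sum => i _; rewrite sumE big_mkcond /=.
apply: ler_sum => j _; case: ifP => // /andP[Gij ij].
have [_ _ h] := HH _ _ Gij ij; apply: le_trans h _.
rewrite ler_wpM2l ?(ltW C0) // -[D x i j ^+ 2]real_normK ?num_real //.
rewrite lerXn2r ?nnegrE //.
have := mx_norm_ge (edge_map G l p x) i (lshift d j).
by rewrite edge_mapl Gij.
Qed.

End Energy.

(** * Flexes and rigidity order *)

Lemma analytic_horner (R : realType) (P : {poly R}) (a : R) :
  analytic_at (horner P) a.
Proof.
pose Q := P \Po ('X + a%:P).
exists (fun m => Q`_m), 1; split=> // t _.
apply: cvg_near_cst; exists (size Q) => //= N QN.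
have -> : P.[t] = Q.[t - a] by rewrite horner_comp !hornerE subrK.
by rewrite (horner_coef_wide _ QN) big_mkord.
Qed.

Section Flexes.
Context {R : realType} {n d : nat}.
Variables (G : rel 'I_n) (l : nat) (p : 'M[R]_(n, d)).
Hypothesis Fp : framework G p.
Hypothesis pp : pinned_pos l p.
Implicit Types x y q : 'M[R]_(n, d).

Lemma pinned_pos_lin (a : R) x y :
  pinned_pos l x -> pinned_pos l y -> pinned_pos l (a *: x + y).
Proof.
by move=> px py i k il ik; rewrite lin_mxE px // py // mulr0 addr0.
Qed.

Lemma pinned_posD x y : pinned_pos l x -> pinned_pos l y -> pinned_pos l (x + y).
Proof. by rewrite -[x in x + y]scale1r; exact: pinned_pos_lin. Qed.

Lemma pinned_posB x y : pinned_pos l x -> pinned_pos l y -> pinned_pos l (x - y).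
Proof. by move=> px py; rewrite addrC -scaleN1r; exact: pinned_pos_lin. Qed.

Lemma edge_map_norm_le x (b : R) : 0 <= b -> pinned_pos l x ->
  (forall i j, G i j -> `|sqdist (p + x) i j - sqdist p i j| <= b) ->
  `|edge_map G l p x| <= b.
Proof.
move=> b0 px H; apply: mx_norm_le => // i j; case: (split_ordP j) => k ->.
  by rewrite edge_mapl; case: ifP => [/H//|_]; rewrite normr0.
by rewrite ((pinned_posP G l p x).1 px) normr0.
Qed.

Lemma sqdist_diff_times (pt : R -> 'M[R]_(n, d)) (r : R) m i j :
  (forall u k, diff_times 0 r m (fun t => pt t u k)) ->
  diff_times 0 r m (fun t => sqdist (pt t) i j).
Proof.
move=> H; have -> : (fun t => sqdist (pt t) i j) =
    (fun t => \sum_(k < d) (pt t i k + -1 * pt t j k) * (pt t i k + -1 * pt t j k)).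
  apply/funext => t; rewrite -[LHS]/(bar (pt t) (pt t) i j) barE.
  by apply: eq_bigr => k _; ring.
apply: diff_times_sum => k; have Hk : diff_times 0 r m (fun t => pt t i k + -1 * pt t j k).
  by apply: diff_timesD => //; apply: diff_timesM => //; exact: diff_times_cst.
exact: diff_timesM.
Qed.

Lemma has_flex_le k k' : (k' <= k)%N -> has_flex G l p 1 k -> has_flex G l p 1 k'.
Proof.
move=> kk' [pt [tr [ac ev]]]; exists pt; split=> //; split=> //.
move=> i j Gij m /andP[m1 mk]; apply: ev => //.
by rewrite m1 (leq_trans mk).
Qed.

(** A trajectory that is 1-active moves at a rate comparable to t, while F is O(t^(k+1)) along it.
    The lower bound would give t^m <= const t^(k+1), impossible for small t if m <= k. *)
Lemma flex_lower_bound_lt k m :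
  has_flex G l p 1 k -> edge_lower_bound G l p m -> (k < m)%N.
Proof.
move=> [pt [[eps [eps0 an pin pt0 _]] [[_ act] ev]]] [c [delta [c0 delta0 Hlow]]].
rewrite ltnNge; apply/negP => mk.
have an0 i j : exists2 r, 0 < r & forall u, diff_times 0 r u (fun t => pt t i j).
  by apply: analytic_diff_times; apply: an; rewrite lexx ltW.
have [r r0 dt] : exists2 r, 0 < r &
    forall u i j, diff_times 0 r u (fun t => pt t i j).
  (* The constant stands for the reciprocal of a radius, so that enlarging it shrinks the ball. *)
  have [] := @fin_uniform_bound R ('I_n * 'I_d)%type R (fun=> 0)
      (fun ij C _ => forall u, diff_times 0 C^-1 u (fun t => pt t ij.1 ij.2)).
  - move=> [i j] _ C C' C0 CC' /= H u; apply: diff_times_radius (H u).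
    by rewrite lef_pV2 ?posrE // (lt_le_trans C0).
  - move=> [i j] /=; have [r r0 H] := an0 i j.
    by exists r^-1, 1; split; rewrite ?invr_gt0 // => _ _ u; rewrite invrK.
  move=> C [e [C0 e0 H]]; exists C^-1; first by rewrite invr_gt0.
  by move=> u i j; exact: (H (i, j) 0).
have [C1 [d1 [C10 d10 H1]]] : exists C e : R, [/\ 0 < C, 0 < e &
    forall t, `|t| < e -> `|pt t - p| <= C * `|t|].
  have [] := @fin_uniform_bound R ('I_n * 'I_d)%type R (fun t => `|t|)
      (fun ij C t => `|pt t ij.1 ij.2 - p ij.1 ij.2| <= C * `|t|).
  - move=> [i j] t C C' C0 CC' /= H; apply: le_trans H _.
    by rewrite ler_wpM2r.
  - move=> [i j] /=.
    have [|C [e [C0 e0 H]]] := @vanishing_bigO R 0%N _ _ r0 (dt 2%N i j).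
      by move=> u; case: u.
    by exists C, e; split=> // t /H; rewrite expr1 pt0.
  move=> C [e [C0 e0 H]]; exists C, e; split=> // t te.
  apply: mx_norm_le; first by rewrite mulr_ge0 // ltW.
  by move=> i j; rewrite !mxE; exact: (H (i, j)).
have [C2 [d2 [C20 d20 H2]]] : exists C e : R, [/\ 0 < C, 0 < e &
    forall t, `|t| < e -> `|t| <= C * `|pt t - p|].
  (* Some entry has a nonzero derivative b at 0; its linear term alone bounds the displacement
     below. *)
  have [i [j [u [u1 D1]]]] : exists i j u, (1 <= u <= 1)%N /\
      derive1n u (fun t => pt t i j) 0 != 0.
    apply: contrapT => no; apply: act => i j u u1; apply/eqP/negPn/negP => D.
    by apply: no; exists i, j, u.
  have u1E : u = 1%N by apply/eqP; rewrite eqn_leq andbC.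
  rewrite {u1}u1E {u u1E} in D1; set b := derive1n 1 _ _ in D1.
  have [C [e [C0 e0 H]]] := taylor r0 (dt 3%N i j).
  have b0 : 0 < `|b| by rewrite normr_gt0.
  exists (2 / `|b|), (Num.min e (`|b| / (2 * C))); split.
  + by rewrite divr_gt0.
  + by rewrite lt_min e0 divr_gt0 // mulr_gt0.
  move=> t; rewrite lt_min => /andP[te]; rewrite ltr_pdivlMr ?mulr_gt0 // => tb.
  have := H t; rewrite subr0 => /(_ te).
  rewrite /taylor_poly !big_ord_recr big_ord0 /= add0r expr0 mulr1 expr1.
  rewrite ?(fact0, factS) ?muln1 !divr1 subr0 pt0 -[_^`() 0]/b.
  rewrite opprD addrA => h.
  have h1 : C * `|t| ^+ 2 <= `|b| / 2 * `|t|.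
    by rewrite expr2 mulrA ler_wpM2r //; lra.
  have h2 : `|b| * `|t| <= `|pt t i j - p i j| + C * `|t| ^+ 2.
    rewrite -normrM; apply: le_trans (lerD (lexx _) h).
    have {1}-> : b * t = (pt t i j - p i j) - (pt t i j - p i j - b * t) by ring.
    exact: ler_normB.
  have h3 : `|pt t i j - p i j| <= `|pt t - p|.
    by have := mx_norm_ge (pt t - p) i j; rewrite !mxE.
  by rewrite mulrAC ler_pdivlMr //; lra.
have [C3 [d3 [C30 d30 H3]]] : exists C e : R, [/\ 0 < C, 0 < e &
    forall t, 0 <= t <= eps -> t < e -> `|edge_map G l p (pt t - p)| <= C * t ^+ k.+1].
  have [] := @fin_uniform_bound R ('I_n * 'I_n)%type R (fun t => `|t|)
      (fun ij C t => G ij.1 ij.2 ->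
        `|sqdist (pt t) ij.1 ij.2 - sqdist p ij.1 ij.2| <= C * `|t| ^+ k.+1).
  - move=> [i j] t C C' C0 CC' /= H Gij; apply: le_trans (H Gij) _.
    by rewrite ler_wpM2r ?exprn_ge0.
  - move=> [i j] /=; have [Gij|nG] := boolP (G i j); last by exists 1, 1.
    have [C [e [C0 e0 H]]] := vanishing_bigO r0
      (sqdist_diff_times i j (dt k.+2)) (ev _ _ Gij).
    by exists C, e; split=> // t /H; rewrite pt0.
  move=> C [e [C0 e0 H]]; exists C, e; split=> // t teps te.
  have /andP[t0 _] := teps.
  apply: edge_map_norm_le.
  - by rewrite mulr_ge0 ?exprn_ge0 // ltW.
  - by apply: pinned_posB => //; exact: pin.
  - move=> i j Gij; rewrite [p + _]addrC subrK.
    by have := H (i, j) t; rewrite ger0_norm //; exact.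
pose b := c * C2^-1 ^+ m.
have b0 : 0 < b by rewrite mulr_gt0 // exprn_gt0 // invr_gt0.
near (0 : R)^'+ => t.
have t0 : 0 < t by near: t; exact: nbhs_right_gt.
have tN : `|t| = t by rewrite gtr0_norm.
have te1 : t < d1 by near: t; exact: nbhs_right_lt.
have te2 : t < d2 by near: t; exact: nbhs_right_lt.
have te3 : t < d3 by near: t; exact: nbhs_right_lt.
have teps : t < eps by near: t; exact: nbhs_right_lt.
have t1 : t < 1 by near: t; exact: nbhs_right_lt.
have tdelta : t < delta / C1.
  by near: t; apply: nbhs_right_lt; rewrite divr_gt0.
have tb : t < b / C3 by near: t; apply: nbhs_right_lt; rewrite divr_gt0.
have := H1 t; have := H2 t; rewrite tN => /(_ te2) h2 /(_ te1) h1.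
have h3 : `|edge_map G l p (pt t - p)| <= C3 * t ^+ k.+1.
  by apply: H3 => //; rewrite !ltW.
have h4 : c * `|pt t - p| ^+ m <= `|edge_map G l p (pt t - p)|.
  apply: Hlow; apply: le_lt_trans h1 _.
  by rewrite mulrC -ltr_pdivlMr.
have h5 : b * t ^+ m <= c * `|pt t - p| ^+ m.
  rewrite -mulrA ler_wpM2l ?(ltW c0) // -exprMn.
  rewrite lerXn2r ?nnegrE ?mulr_ge0 ?invr_ge0 ?(ltW C20) ?(ltW t0) //.
  by rewrite mulrC ler_pdivrMr // mulrC.
have h6 : C3 * t ^+ k.+1 <= C3 * t * t ^+ m.
  rewrite -mulrA ler_wpM2l ?(ltW C30) // -exprS.
  by apply: ler_wiXn2l; rewrite ?ltW.
have : b * t ^+ m <= C3 * t * t ^+ m.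
  exact: le_trans h5 (le_trans h4 (le_trans h3 h6)).
rewrite ler_pM2r ?exprn_gt0 // leNgt => /negP; apply.
by rewrite mulrC -ltr_pdivlMr.
Unshelve. all: by end_near. Qed.

(** * The truncated branch as a trajectory *)

Section Branch.
Variables (m : nat) (z : nat -> 'M[R]_(n, d)) (D : R).
Hypothesis z0 : z 0%N != 0.
Hypothesis zpin : forall i, (i <= m)%N -> pinned_pos l (z i).
Hypothesis D0 : 0 < D.

Definition branch (t : R) : 'M[R]_(n, d) :=
  \sum_(0 <= i < m.+1) t ^+ i.+1 *: z i.

Hypothesis branch_small : forall t : R, `|t| <= 1 ->
  `|edge_map G l p (branch t)| <= D * `|t| ^+ m.+2.

Definition branch_poly (i : 'I_n) (k : 'I_d) : {poly R} :=
  \poly_(j < m.+2) (if j is j'.+1 then z j' i k else p i k).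

Lemma branch_horner i k : (fun t => (p + branch t) i k) = horner (branch_poly i k).
Proof.
apply/funext => t; rewrite horner_poly big_ord_recl /= expr0 mulr1 mxE.
rewrite /branch big_mkord summxE; congr (_ + _); apply: eq_bigr => j _.
by rewrite mxE mulrC.
Qed.

(** For small t the term t z_0 outweighs the others, whose sum is at most A t^2. The bound makes the
    branch non-constant and lets powers of t be traded for powers of the displacement. *)
Lemma branch_lower : exists a e : R, [/\ 0 < a, 0 < e, e <= 1 &
  forall t, `|t| < e -> a * `|t| <= `|branch t|].
Proof.
pose A := 1 + \sum_(0 <= i < m) `|z i.+1|.
have A0 : 0 < A by rewrite ltr_pwDl // sumr_ge0.
have N0 : 0 < `|z 0%N| by rewrite normr_gt0.
exists (`|z 0%N| / 2), (Num.min 1 (`|z 0%N| / (2 * A))); split.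
- by rewrite divr_gt0.
- by rewrite lt_min ltr01 divr_gt0 // mulr_gt0.
- by rewrite ge_min lexx.
move=> t; rewrite lt_min => /andP[t1]; rewrite ltr_pdivlMr ?mulr_gt0 // => tA.
have t0 : 0 <= `|t| by [].
rewrite /branch big_nat_recl // expr1.
set Y := \sum_(_ <= _ < _) _.
have HY : `|Y| <= A * `|t| ^+ 2.
  rewrite mulrDl mul1r ler_wpDl ?exprn_ge0 // mulr_suml.
  apply: le_trans (ler_norm_sum _ _ _) _; apply: ler_sum => i _.
  rewrite normrZ normrX mulrC ler_wpM2l // !exprS.
  rewrite !ler_wpM2l // expr0 exprn_ile1 // ltW //.
have h1 : A * `|t| ^+ 2 <= `|z 0%N| / 2 * `|t|.
  by rewrite expr2 mulrA ler_wpM2r //; lra.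
have h2 : `|t| * `|z 0%N| <= `|t *: z 0%N + Y| + `|Y|.
  rewrite -normrZ -{1}[t *: z 0%N](addrK Y); exact: ler_normB.
by lra.
Qed.

Lemma branch_pinned t : pinned_pos l (branch t).
Proof.
rewrite /branch big_nat; elim/big_ind: _ => [i k _ _|x y|i /andP[_ im]].
- by rewrite mxE.
- exact: pinned_posD.
- by move=> u k ul uk; rewrite mxE zpin ?mulr0.
Qed.

Lemma branch0 : branch 0 = 0.
Proof. by rewrite /branch big1 // => i _; rewrite expr0n scale0r. Qed.

Lemma branch_trajectory : trajectory l p (fun t => p + branch t) 1.
Proof.
split=> //.
- by move=> t _ i k; rewrite branch_horner; exact: analytic_horner.
- by move=> t _; apply: pinned_posD => //; exact: branch_pinned.
- by rewrite branch0 addr0.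
have [a [e [a0 e0 e1 H]]] := branch_lower; exists (e / 2).
have e20 : 0 < e / 2 by rewrite divr_gt0.
split; first by rewrite (ltW e20); lra.
rewrite -subr_eq0 addrC addKr -normr_gt0; apply: lt_le_trans (H _ _).
  by rewrite gtr0_norm // mulr_gt0.
by rewrite gtr0_norm //; lra.
Qed.

(** The velocity at 0 is the nonzero [z 0], and F = O(t^(m+2)) means (m+1)-vanishing. *)
Lemma branch_flex : has_flex G l p 1 m.+1.
Proof.
exists (fun t => p + branch t); split; first by exists 1; exact: branch_trajectory.
split.
  split=> [i k u|tv]; first by case: u.
  move: z0 => /eqP; apply; apply/matrixP => i k; rewrite mxE.
  have := tv i k 1%N isT.
  rewrite branch_horner derive1n1 -derivE horner_coef0 coef_deriv mulr1n.
  by rewrite coef_poly.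
move=> i j Gij.
apply: (@bigO_vanishing R m.+1 _ 1 D 1) => //.
  apply: sqdist_diff_times => u k; rewrite branch_horner.
  exact: diff_times_horner.
move=> t /andP[t0 t1]; have tN : `|t| = t by rewrite gtr0_norm.
have := branch_small; move=> /(_ t); rewrite tN => /(_ (ltW t1)).
apply: le_trans; rewrite branch0 addr0.
have := mx_norm_ge (edge_map G l p (branch t)) i (lshift d j).
by rewrite edge_mapl Gij.
Qed.

Lemma branch_slow Eb : stiff_bar G p Eb ->
  grows_sometimes_slowly l (energy G Eb) p (2 * m.+2%:R).
Proof.
move=> /(energy_bounds l Fp)[C [delta [C0 delta0 HE]]].
have [a [e [a0 e0 e1 Ha]]] := branch_lower.
have [A A0 HA] : exists2 A : R, 0 < A & forall t, `|t| <= 1 -> `|branch t| <= A * `|t|.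
  exists (1 + \sum_(0 <= i < m.+1) `|z i|); first by rewrite ltr_pwDl // sumr_ge0.
  move=> t t1; rewrite mulrDl mul1r ler_wpDl // mulr_suml.
  apply: le_trans (ler_norm_sum _ _ _) _; apply: ler_sum => i _.
  rewrite normrZ mulrC ler_wpM2l // normrX exprS.
  by rewrite -[leRHS]mulr1 ler_wpM2l // exprn_ile1.
pose g := Num.min (e / 2) (delta / (2 * A)).
have g0 : 0 < g by rewrite lt_min !divr_gt0 // mulr_gt0.
have ge : g <= e / 2 by rewrite ge_min lexx.
have gd : g <= delta / (2 * A) by rewrite ge_min lexx orbT.
pose c2 := C * D ^+ 2 * (a ^+ m.+2)^-1 ^+ 2.
have ap : 0 < a ^+ m.+2 by rewrite exprn_gt0.
exists (fun t => p + branch t), 1, c2, g; split=> //.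
- exact: branch_trajectory.
- by rewrite /c2 !mulr_gt0 ?exprn_gt0 ?invr_gt0.
- by lra.
move=> t /andP[t0 tg]; have tN : `|t| = t by rewrite ger0_norm.
have t1 : t <= 1 by lra.
have te : t < e by lra.
have tdelta : `|branch t| < delta.
  apply: le_lt_trans (HA t _) _; rewrite tN //.
  apply: (@le_lt_trans _ _ (A * (delta / (2 * A)))).
    by rewrite ler_wpM2l ?(ltW A0) // (le_trans tg).
  by have -> : A * (delta / (2 * A)) = delta / 2; [field; rewrite gt_eqF|lra].
have [_ ub] := HE _ (branch_pinned t) tdelta; apply: le_trans ub _.
rewrite addrC addKr -natrM powR_mulrn ?sqrtr_ge0 // [(2 * _)%N]mulnC exprM.
have h1 : `|edge_map G l p (branch t)| ^+ 2 <= D ^+ 2 * (t ^+ m.+2) ^+ 2.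
  have bs : `|edge_map G l p (branch t)| <= D * t ^+ m.+2.
    by have := branch_small (t := t); rewrite tN => /(_ t1).
  rewrite -exprMn; apply: lerXn2r => //; rewrite nnegrE //; exact: le_trans bs.
have h2 : (t ^+ m.+2) ^+ 2 <= (a ^+ m.+2)^-1 ^+ 2 * (cnorm (branch t) ^+ m.+2) ^+ 2.
  have bs : a * t <= cnorm (branch t).
    by apply: le_trans (le_norm_cnorm _); have := Ha t; rewrite tN => /(_ te).
  have tk : 0 <= t ^+ m.+2 by exact: exprn_ge0.
  have bk : t ^+ m.+2 <= (a ^+ m.+2)^-1 * cnorm (branch t) ^+ m.+2.
    rewrite ler_pdivlMl // -exprMn.
    have at0 : 0 <= a * t by rewrite mulr_ge0 // ltW.
    by apply: lerXn2r => //; rewrite nnegrE // sqrtr_ge0.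
  rewrite -exprMn; apply: lerXn2r => //; rewrite nnegrE //; exact: le_trans bk.
have h3 := le_trans h1 (ler_wpM2l (sqr_ge0 D) h2).
by apply: le_trans (ler_wpM2l (ltW C0) h3) _; rewrite /c2 !mulrA.
Qed.

End Branch.

Lemma edge_lower_bound_rigid k : edge_lower_bound G l p k.+1 -> rigid G l p.
Proof.
move=> [c [delta [c0 delta0 H]]]; exists delta; split=> // q pq qd eqv.
have px : pinned_pos l (q - p) by exact: pinned_posB.
have := H (q - p) (le_lt_trans (le_norm_cnorm _) qd).
have F0 : `|edge_map G l p (q - p)| <= 0.
  apply: edge_map_norm_le => // i j Gij.
  by rewrite [p + _]addrC subrK -!sqr_dist eqv // subrr normr0.
move=> /le_trans/(_ F0); rewrite pmulr_rle0 // => h.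
have : `|q - p| ^+ k.+1 = 0 by apply/le_anti; rewrite h exprn_ge0.
by move/eqP; rewrite expf_eq0 /= normr_eq0 subr_eq0 => /eqP.
Qed.

Lemma edge_lower_bound_quick k Eb : edge_lower_bound G l p k -> stiff_bar G p Eb ->
  grows_always_quickly l (energy G Eb) p (2 * k%:R).
Proof.
move=> [c [delta [c0 delta0 H]]] /(energy_bounds l Fp)[C [e [C0 e0 HE]]].
have [K K0 HK] := @cnorm_le_norm R n d.
have ck : 0 < C * (K ^+ k / c) ^+ 2.
  by rewrite mulr_gt0 // exprn_gt0 // divr_gt0 // exprn_gt0.
exists (C * (K ^+ k / c) ^+ 2)^-1, (Num.min delta e); split.
- by rewrite invr_gt0.
- by rewrite lt_min delta0.
move=> q pq; rewrite lt_min => /andP[qd qe].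
have px : pinned_pos l (q - p) by exact: pinned_posB.
have [lb _] := HE _ px (le_lt_trans (le_norm_cnorm _) qe).
have low := H _ (le_lt_trans (le_norm_cnorm _) qd).
rewrite [p + _]addrC subrK in lb.
rewrite -natrM powR_mulrn ?sqrtr_ge0 // [(2 * _)%N]mulnC exprM.
rewrite ler_pdivrMl //.
have h1 : cnorm (q - p) ^+ k <= K ^+ k / c * `|edge_map G l p (q - p)|.
  apply: (@le_trans _ _ (K ^+ k * `|q - p| ^+ k)).
    by rewrite -exprMn lerXn2r ?nnegrE ?mulr_ge0 ?sqrtr_ge0 ?(ltW K0).
  rewrite -mulrA ler_wpM2l ?exprn_ge0 ?(ltW K0) //.
  by rewrite ler_pdivlMl.
apply: (@le_trans _ _ ((K ^+ k / c) ^+ 2 * `|edge_map G l p (q - p)| ^+ 2)).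
  rewrite -exprMn lerXn2r ?nnegrE ?exprn_ge0 ?sqrtr_ge0 //.
  by rewrite mulr_ge0 // divr_ge0 ?exprn_ge0 ?ltW.
apply: le_trans (ler_wpM2l (sqr_ge0 _) lb) _.
by rewrite /= mulrA [_ * C]mulrC.
Qed.

Lemma slow_branch_flex m : slow_branch G l p m -> has_flex G l p 1 m.+1.
Proof. by move=> [z [z0 zp [D D0 HD]]]; exact: branch_flex HD. Qed.

Lemma slow_branch_order m : slow_branch G l p m -> edge_lower_bound G l p m.+2 ->
  rigidity_order G l p m.+2%:R.
Proof.
move=> [z [z0 zp [D D0 HD]]] low Eb sb; split.
- by rewrite mulr_gt0.
- exact: edge_lower_bound_quick.
- exact: branch_slow HD _ sb.
Qed.

End Flexes.

(** If all obstructions vanish, flexes of every order exist, so the first claim is vacuous, and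
    zeros of F near 0 refute rigidity. Otherwise (1,k)-flexes exist, for k >= 1, exactly when k <= m
    + 1, and the rigidity order is m + 2. *)
Theorem theorem5p3 (R : realType) (n d l : nat) (G : rel 'I_n) (p : 'M[R]_(n, d)) :
  framework G p -> pinned l p -> dimK1 G l p ->
  (forall k : nat, (2 <= k)%N ->
     has_flex G l p 1 k.-1 -> ~ has_flex G l p 1 k ->
     rigid G l p /\ rigidity_order G l p k%:R) /\
  (forall k : nat, (2 <= k)%N ->
     has_flex G l p 1 k ->
     ~ rigid G l p \/
     (rigid G l p /\ exists nu : R, rigidity_order G l p nu /\ k.+1%:R <= nu)).
Proof.
move=> Fp [_ _ _ pp] K1.
have [[branches zeros]|[m [br low]]] := edge_map_alternative K1.
  split=> [k _ _ []|k _ _].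
    exact: has_flex_le (leqnSn k) (slow_branch_flex pp (branches k)).
  left=> -[e [e0 rig]].
  have [K K0 HK] := @cnorm_le_norm R n d.
  have [|x [x0 xe Fx]] := zeros (e / K); first by rewrite divr_gt0.
  apply: x0; have px : pinned_pos l x.
    by apply/(pinned_posP G l p) => i h; rewrite Fx mxE.
  suff : p + x = p by move=> /(canRL (addKr p)); rewrite addNr.
  apply: rig; first exact: pinned_posD.
    rewrite addrC addKr; apply: le_lt_trans (HK x) _.
    by rewrite mulrC -ltr_pdivlMr.
  move=> i j Gij; congr Num.sqrt; apply/eqP; rewrite -subr_eq0.
  have /matrixP/(_ i (lshift d j)) := Fx.
  by rewrite edge_mapl Gij mxE => ->.
have rg := edge_lower_bound_rigid pp low.
have ord := slow_branch_order Fp pp br low.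
split=> k k2 fl => [nfl|].
  (* The (1,k-1)-flex gives k - 1 < m + 2; the branch is a (1,m+1)-flex, so the absence of a
     (1,k)-flex gives k > m + 1. *)
  have km : k = m.+2.
    apply/eqP; rewrite eqn_leq; apply/andP; split.
      by have := flex_lower_bound_lt pp fl low; rewrite prednK // ltnW.
    rewrite leqNgt; apply/negP; rewrite ltnS => km; apply: nfl.
    exact: has_flex_le km (slow_branch_flex pp br).
  by rewrite km.
right; split=> //; exists m.+2%:R; split=> //.
by rewrite ler_nat; have := flex_lower_bound_lt pp fl low.
Qed.
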